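(* Let $G=(V,E)$ be a connected graph with bounded degree. If $\mathrm{Dim}(G)>4$, then $p_c(G)<1$.
   Context: Bounded degree means $\sup_{x\in V}d(x)<\infty$, where $d(x)$ is the number of $y\in V$ with $xy\in E$. For a real number $d$, $G$ satisfies an isoperimetric inequality of dimension $d$ if there exists a constant $c>0$ such that $|\partial K|\ge c|K|^{(d-1)/d}$ for all finite (nonempty) $K\subset V$, where $\partial K:=\{\{x,y\}\in E: x\in K,\ y\notin K\}$ is the edge boundary of $K$. The isoperimetric dimension $\mathrm{Dim}(G)$ is the supremum of all $d$ such that $G$ satisfies an isoperimetric inequality of dimension $d$. For $p\in[0,1]$, $\mathbf{P}_p$ is Bernoulli bond percolation on $G$: each edge is independently open with probability $p$ and closed otherwise. $\{x\leftrightarrow\infty\}$ is the event that $x$ belongs to an infinite connected component of the graph with vertex set $V$ and the open edges. The critical parameter is $p_c(G):=\inf\{p\in[0,1]:\mathbf{P}_p[x\leftrightarrow\infty]>0\}$, where $x\in V$ is arbitrary (the value does not depend on $x$). *)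

(* Defs.v *)
From HB Require Import structures.
From mathcomp Require Import all_boot all_order all_algebra finmap.
From mathcomp Require Import all_classical all_reals all_analysis.
From mathcomp Require Import ring lra.

Set Implicit Arguments.
Unset Strict Implicit.
Unset Printing Implicit Defensive.

Import Order.TTheory GRing.Theory Num.Theory.
Import numFieldNormedType.Exports.

Local Open Scope classical_set_scope.
Local Open Scope ring_scope.

Definition config (I : Type) : Type := I -> bool.
HB.instance Definition _ (I : Type) := Pointed.on (config I).

Section cylinders.
Variable I : choiceType.

Definition determined_by (s : seq I) (A : set (config I)) :=
  forall w w' : config I, {in s, w =1 w'} -> A w -> A w'.

Definition cylinder : set (set (config I)) :=
  [set A | exists s, determined_by s A].

Lemma determined_byE s (A : set (config I)) : determined_by s A ->
  forall w w', {in s, w =1 w'} -> A w = A w'.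
Proof.
move=> dA w w' ww'; apply/propext; split; apply: dA => // i /ww'.
by [].
Qed.

Lemma determined_by_sub s t A : {subset s <= t} -> determined_by s A ->
  determined_by t A.
Proof. by move=> st dA w w' ww'; apply: dA => i /st /ww'. Qed.

Lemma cylinder0 : cylinder set0.
Proof. by exists [::]. Qed.

Lemma cylinderU : setU_closed cylinder.
Proof.
move=> A B [s dA] [t dB]; exists (s ++ t) => w w' ww' [Aw|Bw].
- by left; apply: dA Aw => i si; apply: ww'; rewrite mem_cat si.
- by right; apply: dB Bw => i ti; apply: ww'; rewrite mem_cat ti orbT.
Qed.

Lemma cylinderC : setC_closed cylinder.
Proof.
move=> A [s dA]; exists s => w w' ww' nAw Aw'.
by apply: nAw; apply: dA Aw' => i /ww'.
Qed.

End cylinders.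

Fact cylinder_display : measure_display. Proof. exact. Qed.

HB.instance Definition _ (I : choiceType) :=
  @isAlgebraOfSets.Build cylinder_display (config I) (@cylinder I)
    (@cylinder0 I) (@cylinderU I) (@cylinderC I).

(* The product sigma-algebra on {0,1}^I. *)
Definition config_space (I : choiceType) :=
  g_sigma_algebraType (@measurable _ (config I)).
HB.instance Definition _ (I : choiceType) := Measurable.on (config_space I).

Definition config_topology (I : choiceType) : Type :=
  prod_topology (fun _ : I => bool).
HB.instance Definition _ (I : choiceType) :=
  Pointed.copy (config_topology I) (config I).
HB.instance Definition _ (I : choiceType) :=
  Topological.copy (config_topology I) (prod_topology (fun _ : I => bool)).

Section bernoulli_content.
Context {R : realType} {I : choiceType}.
Variable p : {i01 R}.
Local Notation q := (p%:num : R).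
Implicit Types (f g : config I -> R) (w : config I) (s t : seq I).

Definition upd w i b : config I := fun j => if j == i then b else w j.

(* Integration over the coordinate i, with the others held fixed. *)
Definition avg i f : config I -> R :=
  fun w => q * f (upd w i true) + (1 - q) * f (upd w i false).

Definition avgs s f := foldr avg f s.

Local Lemma q0 : 0 <= q. Proof. by []. Qed.
Local Lemma q1 : q <= 1. Proof. by []. Qed.

Lemma upd_comm w i j b c : i != j ->
  upd (upd w i b) j c = upd (upd w j c) i b.
Proof.
move=> ij; apply/funext => k; rewrite /upd.
by case: (eqVneq k j) => [->|//]; rewrite eq_sym (negbTE ij).
Qed.

Lemma avgC i j f : avg i (avg j f) = avg j (avg i f).
Proof.
have [->//|ij] := eqVneq i j.
apply/funext => w; rewrite /avg !(upd_comm w _ _ ij); ring.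
Qed.

Lemma avgs_avg s i f : avgs s (avg i f) = avg i (avgs s f).
Proof. by elim: s => //= j s ->; exact: avgC. Qed.

Lemma avgsC s t f : avgs s (avgs t f) = avgs t (avgs s f).
Proof. by elim: s => //= i s ->; rewrite avgs_avg. Qed.

Lemma avgs_cst s (c : R) : avgs s (cst c) = cst c.
Proof.
by elim: s => //= i s ->; apply/funext => w; rewrite /avg /cst; ring.
Qed.

Lemma avgsD s f g : avgs s (f \+ g) = avgs s f \+ avgs s g.
Proof.
by elim: s => //= i s ->; apply/funext => w; rewrite /avg /=; ring.
Qed.

Lemma avgs_ge0 s f : (forall w, 0 <= f w) -> forall w, 0 <= avgs s f w.
Proof.
move=> f0; elim: s => //= i s IH w.
by rewrite /avg addr_ge0// mulr_ge0 ?q0// subr_ge0 q1.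
Qed.

Lemma avgs_mull s i (h : bool -> R) f : i \notin s ->
  avgs s (fun w => h (w i) * f w) = (fun w => h (w i) * avgs s f w).
Proof.
elim: s => //= j s IH; rewrite inE negb_or => /andP[ij /IH->].
by apply/funext => w; rewrite /avg /upd (negbTE ij); ring.
Qed.

Definition depends_on s f := forall w w', {in s, w =1 w'} -> f w = f w'.

Lemma avgs_dep s t f : depends_on (s ++ t) f -> depends_on t (avgs s f).
Proof.
elim: s t => //= i s IH t df w w' ww'; rewrite /avg.
have dg : depends_on (i :: t) (avgs s f).
  apply: IH => v v' vv'; apply: df => j; rewrite inE mem_cat => jst.
  by apply: vv'; rewrite mem_cat inE orbCA.
by congr (_ * _ + _ * _); apply: dg => j; rewrite inE /upd;
  case: eqP => //= _ /ww'.
Qed.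

Lemma avgs_const s f w w' : depends_on s f -> avgs s f w = avgs s f w'.
Proof. by move=> df; apply: (@avgs_dep s [::]) => //; rewrite cats0. Qed.

Lemma avgs_indep s t f w w' : depends_on s f -> depends_on t f -> avgs s f w = avgs t f w'.
Proof.
move=> ds dt.
have es : avgs s f = cst (avgs s f w) by apply/funext => v; exact: avgs_const.
have et : avgs t f = cst (avgs t f w') by apply/funext => v; exact: avgs_const.
have := congr1 (@^~ w) (avgsC s t f).
by rewrite et es !avgs_cst.
Qed.

Local Lemma dep_indic s A : determined_by s A -> depends_on s \1_A.
Proof.
move=> dA w w' ww'; rewrite !indicE.
by have e := determined_byE dA ww'; rewrite /in_mem /= /in_set /= e.
Qed.

(* The probability that A occurs when the coordinates in a finite set
   determining A are averaged out; junk if A is not a cylinder event. *)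
Definition bernoulli_content (A : set (config I)) : \bar R :=
  (avgs (xget [::] [set s | determined_by s A]) \1_A (fun=> true))%:E.

Lemma bernoulli_contentE s A w : determined_by s A ->
  bernoulli_content A = (avgs s \1_A w)%:E.
Proof.
move=> dA; rewrite /bernoulli_content; congr (_%:E).
apply: avgs_indep; last exact: dep_indic.
by apply: dep_indic; case: xgetP => [//|/(_ s)].
Qed.

Local Open Scope ereal_scope.

Lemma bernoulli_content0 : bernoulli_content set0 = 0.
Proof.
rewrite (@bernoulli_contentE [::] _ (fun=> true))//=.
by rewrite indicE in_set0.
Qed.

Lemma bernoulli_contentT : bernoulli_content setT = 1.
Proof.
rewrite (@bernoulli_contentE [::] _ (fun=> true))//=.
by rewrite indicE in_setT.
Qed.

Lemma bernoulli_content_ge0 A : 0 <= bernoulli_content A.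
Proof. by rewrite /bernoulli_content lee_fin avgs_ge0. Qed.

Lemma bernoulli_content_additive2 : semi_additive2 bernoulli_content.
Proof.
move=> A B [s dA] [t dB] _ AB.
have {}dA : determined_by (s ++ t) A.
  by apply: determined_by_sub dA => i; rewrite mem_cat => ->.
have {}dB : determined_by (s ++ t) B.
  by apply: determined_by_sub dB => i; rewrite mem_cat orbC => ->.
have dAB : determined_by (s ++ t) (A `|` B).
  by move=> w w' ww' [/(dA _ _ ww')|/(dB _ _ ww')]; [left|right].
rewrite (bernoulli_contentE (fun=> true) dA).
rewrite (bernoulli_contentE (fun=> true) dB).
rewrite (bernoulli_contentE (fun=> true) dAB) -EFinD; congr (_%:E).
have -> : \1_(A `|` B) = (\1_A \+ \1_B)%R :> (config I -> R).
  apply/funext => w; rewrite /= !indicE in_setU.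
  have : ~~ ((w \in A) && (w \in B)) by rewrite -in_setI AB in_set0.
  by case: (w \in A); case: (w \in B) => //= _; rewrite ?(addr0, add0r).
by rewrite avgsD.
Qed.

Lemma bernoulli_content_additive :
  measure_function.semi_additive bernoulli_content.
Proof.
apply/additive2P; first exact: bernoulli_content0.
by rewrite -semi_additive2E; exact: bernoulli_content_additive2.
Qed.

HB.instance Definition _ := isContent.Build cylinder_display (config I) R
  bernoulli_content bernoulli_content_ge0 bernoulli_content_additive.

Lemma cylinder_open (A : set (config I)) : measurable A ->
  open (A : set (config_topology I)).
Proof.
move=> [s dA]; rewrite openE => w Aw.
suff : nbhs (w : config_topology I) [set w' | {in s, w =1 w'}].
  by apply: filterS => w' /dA; exact.
elim: s {dA} => [|i s IH]; first by apply: filterS filterT => ? _ ?.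
have : nbhs (w : config_topology I) [set w' | w' i = w i].
  have c := @proj_continuous I (fun _ => bool) i w.
  apply: (c [set b | b = w i]).
  by apply: open_nbhs_nbhs; split => //; exact: discrete_open.
apply: filterS2 IH => w' ws wi j; rewrite inE => /predU1P[->//|].
by exact: ws.
Qed.

Lemma bernoulli_content_sigma_subadditive :
  measurable_subset_sigma_subadditive bernoulli_content.
Proof.
move=> A F mF mA AF.
have cA : compact (A : set (config_topology I)).
  apply: (@subclosed_compact _ _ setT) => //.
    by rewrite -openC; apply: cylinder_open; exact: measurableC.
  have := @tychonoff I (fun _ => bool) _ (fun=> bool_compact).
  by congr (compact _); rewrite eqEsubset.
have := cA; rewrite (@compact_cover (config_topology I)).
move=> /(_ nat setT F) [i _|w /AF[n _ Fw]|D _ DF]; first exact: cylinder_open.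
  by exists n.
pose N := (\max_(i <- enum_fset D) i).+1.
apply: (@le_trans _ _ (\sum_(i < N) bernoulli_content (F i))).
  apply: content_subadditive => //.
  rewrite -bigcup_mkord => w /DF[n nD Fw]; exists n => //=.
  by rewrite /N ltnS; apply: (@leq_bigmax_seq _ (enum_fset D) xpredT id n nD).
rewrite -(big_mkord xpredT (fun i => bernoulli_content (F i))).
by apply: nneseries_lim_ge => *; exact: bernoulli_content_ge0.
Qed.

HB.instance Definition _ := Content_SigmaSubAdditive_isMeasure.Build
  cylinder_display R (config I) bernoulli_content
  bernoulli_content_sigma_subadditive.

(* The law of an i.i.d. family of Bernoulli(p) variables indexed by I. *)
Definition bernoulli_product : set (config_space I) -> \bar R :=
  measure_extension bernoulli_content.

HB.instance Definition _ := Measure.on bernoulli_product.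

Lemma bernoulli_product_cylinder A : cylinder A ->
  bernoulli_product A = bernoulli_content A.
Proof. by move=> cA; exact: measurable_mu_extE. Qed.

Lemma bernoulli_productT : bernoulli_product setT = 1.
Proof.
by rewrite bernoulli_product_cylinder ?bernoulli_contentT//; exists [::].
Qed.

HB.instance Definition _ :=
  Measure_isProbability.Build _ _ _ bernoulli_product bernoulli_productT.

Lemma bernoulli_productE (s : seq I) (b : config I) : uniq s ->
  bernoulli_product [set w : config I | {in s, w =1 b}] =
  (\prod_(i <- s) (if b i then q else 1 - q)%R)%:E.
Proof.
move=> us.
have ds t : determined_by t [set w : config I | {in t, w =1 b}].
  by move=> w w' ww' + i it => /(_ i it) <-; rewrite ww'.
rewrite bernoulli_product_cylinder; last by exists s.
rewrite (bernoulli_contentE b (ds s)); congr (_%:E).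
rewrite -[RHS]/(cst _ b : R); congr (_ b).
elim: s us => [_|i s IH /= /andP[si us]]; apply/funext => w.
  by rewrite big_nil /= indicE mem_set.
have -> : \1_[set w : config I | {in i :: s, w =1 b}] =
    (fun w => (w i == b i)%:R * \1_[set w : config I | {in s, w =1 b}] w)%R
    :> (config I -> R).
  apply/funext => v; rewrite !indicE -natrM mulnb; congr (nat_of_bool _)%:R.
  apply/idP/andP => [|[/eqP vi]]; rewrite !inE /= => vs.
    split; first by apply/eqP/vs; rewrite inE eqxx.
    by move=> k ks; apply: vs; rewrite inE ks orbT.
  by move=> k; rewrite inE => /predU1P[->//|/vs].
rewrite (avgs_mull (fun c => (c == b i)%:R) _ si) IH//.
rewrite big_cons /avg /cst /upd eqxx.
by case: (b i); rewrite /= ?(mul1r, mul0r, mulr0, addr0, add0r).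
Qed.

End bernoulli_content.

(* A simple graph: edges are two-element sets of vertices. *)
Record graph := Graph {
  vertex :> choiceType;
  edges : set {fset vertex};
  edges_card2 : forall e, edges e -> #|` e|%fset = 2 }.
Arguments edges : clear implicits.

Section graphs.
Variables (R : realType) (G : graph).
Implicit Types (x y : G) (K : {fset G}) (d : R).

Definition edge : choiceType := set_type (edges G).

Definition adjacent : rel G := fun x y => `[< edges G [fset x; y]%fset >].

Definition linked (r : rel G) x y :=
  exists2 s : seq G, path r x s & last x s = y.

Definition connected_graph := forall x y, linked adjacent x y.

Definition degree x : \bar R := counting [set y | adjacent x y].

Definition bounded_degree := (ereal_sup (range degree) < +oo)%E.

Definition edge_boundary K : set {fset G} :=
  [set e | edges G e /\
     exists x y, [/\ x \in K, y \notin K & e = [fset x; y]%fset]].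

(* At d = 0, where (d - 1) / d is meaningless, the exponent evaluates to 0 and
   the property coincides with the one at d = 1; the supremum defining the
   isoperimetric dimension is therefore unaffected. *)
Definition isoperimetric d := exists2 c : R, 0 < c &
  forall K, K != fset0%fset ->
    ((c * (#|` K|%fset)%:R `^ ((d - 1) / d))%:E
       <= counting (edge_boundary K))%E.

Definition isoperimetric_dim : \bar R :=
  ereal_sup [set d%:E | d in [set d | isoperimetric d]].

Definition open_adjacent (w : config_space edge) : rel G :=
  fun x y => `[< exists2 e : edge, w e & val e = [fset x; y]%fset >].

Definition cluster_of (w : config_space edge) x : set G :=
  [set y | linked (open_adjacent w) x y].

Definition connected_to_infinity x : set (config_space edge) :=
  [set w | infinite_set (cluster_of w x)].

(* [inf] of the empty set is 0, but p = 1 belongs to the set below as soon as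
   the graph is infinite and connected. *)
Definition critical_parameter x : R :=
  inf [set (p%:num : R) | p in
    [set p : {i01 R} | (0 < bernoulli_product p (connected_to_infinity x))%E]].

End graphs.

Arguments connected_graph : clear implicits.
Arguments bounded_degree : clear implicits.
Arguments isoperimetric_dim : clear implicits.
Arguments critical_parameter : clear implicits.

(* Main.v *)
(* Peierls' argument: if the cluster of x is finite, then x lies in a finite set
   K all of whose boundary edges are closed, and taking |dK| minimal makes both K
   and its complement connected. It remains to see that at most C^n such K have
   |dK| = n, for which we use spanning forests of a finite region W containing
   these K, rooted outside W.
   Gluing a spanning tree of K, rooted at some boundary vertex x_K, to a rooted
   spanning forest of W \ K gives a spanning forest of W, from which K can be
   decoded once the position of x_K on the path starting at x is known; there are
   only polynomially many (in n) such positions. So it suffices that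
   tau(W) <= C^n tau(K) tau(W \ K), where tau counts forests. Cutting a forest of
   W along dK produces forests of the two sides with additional roots Y on the
   boundary, and these roots are removed one at a time: the ratio of the numbers
   of forests with root sets Y \ y and Y is the conductance between y and the other
   roots. The potentials h_y sum to at most 1, so the sets {h_y > 1/2} are disjoint
   and one of them meets at most m = n/|Y| boundary vertices; its level sets inherit
   the isoperimetric inequality up to an error O(m), which makes the conductance at
   least of order m^-6. The product of these losses is at most C^n. Only
   |dA| >= c |A|^(2/3) is used. *)
From Pilot Require Import Defs.
From mathcomp Require Import all_boot all_order all_algebra.
From mathcomp Require Import finmap zify ring lra.

Set Implicit Arguments.
Unset Strict Implicit.
Unset Printing Implicit Defensive.

Import Order.TTheory GRing.Theory Num.Theory.

(** * Rooted spanning forests of a finite graph, encoded by parent maps *)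

Section RootedForests.
Local Open Scope nat_scope.
Variables (T : finType) (r : rel T).
Implicit Types (S : {set T}) (f g : {ffun T -> T}).

Definition froot f v := iter #|T| f v.

(** The vertices outside [S] are the roots, encoded as fixed points. The condition on [froot]
    excludes cycles, since [#|T|] steps lead along any acyclic path to its root. *)
Definition forests S : {set {ffun T -> T}} :=
  [set f : {ffun T -> T} | [forall v, if v \in S then r v (f v) else f v == v] &&
           [forall v, froot f v \notin S]].

Lemma forestsP S f :
  reflect [/\ forall v, v \in S -> r v (f v), forall v, v \notin S -> f v = v
            & forall v, froot f v \notin S]
          (f \in forests S).
Proof.
rewrite inE; apply: (iffP andP) => [[/forallP h1 /forallP h2]|[h1 h2 h3]].
  split=> // v vS; have := h1 v; first by rewrite vS.
  by rewrite (negbTE vS) => /eqP.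
split; apply/forallP => v //.
by case: ifP => [/h1 //|/negbT/h2->].
Qed.

Lemma iter_outside S (f : T -> T) v i j : (forall u, u \notin S -> f u = u) ->
  i <= j -> iter i f v \notin S -> iter j f v = iter i f v.
Proof.
by move=> fS ij vi; rewrite -(subnK ij) iterD iter_fix //; exact: fS.
Qed.

(** If the first [#|S|.+1] iterates all lay in [S], two of them would coincide and the orbit would
    cycle inside [S] forever. *)
Lemma iter_exit S (f : T -> T) v i : (forall u, u \notin S -> f u = u) ->
  iter i f v \notin S -> iter #|S| f v \notin S.
Proof.
move=> fS vi; apply/negP => vS.
have inS j : j <= #|S| -> iter j f v \in S.
  by move=> jS; apply: contraLR vS => jS'; rewrite (iter_outside fS jS jS').
have trS : {subset traject f v #|S|.+1 <= S}.
  by move=> u /trajectP[j jS ->]; exact: inS.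
have : looping f v #|S|.
  apply: contraT; rewrite -looping_uniq => us.
  have := uniq_leq_size us (s2 := enum S).
  rewrite size_traject -cardE ltnn => -> // u /trS.
  by rewrite mem_enum.
move=> /loopingP /(_ i) /trajectP[j jS vij].
by move: vi; rewrite vij inS // ltnW.
Qed.

Lemma froot_eq S f v i : (forall u, u \notin S -> f u = u) ->
  iter i f v \notin S -> froot f v = iter i f v.
Proof.
move=> fS vi; have vS := iter_exit fS vi.
rewrite /froot (iter_outside fS (max_card S) vS).
by case: (leqP #|S| i) => [h|/ltnW h];
  [rewrite (iter_outside fS h vS)|rewrite (iter_outside fS h vi)].
Qed.

Lemma froot_outside S f v : f \in forests S -> v \notin S -> froot f v = v.
Proof. by move=> /forestsP[_ h _] vS; apply: (@froot_eq S f v 0 h). Qed.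

Lemma iter_agree (x : T) (f g : T -> T) v n : (forall u, u != x -> f u = g u) ->
  iter n f v = iter n g v \/
  exists2 i, i <= n & iter i f v = x /\ iter i g v = x.
Proof.
move=> fg; elim: n => [|n [IH|[i ni h]]]; [by left| |by right; exists i => //; exact: leqW].
have [e|ne] := eqVneq (iter n f v) x.
  by right; exists n => //; rewrite -IH.
by left; rewrite !iterS -IH fg.
Qed.

Definition upd f x w : {ffun T -> T} := [ffun v => if v == x then w else f v].

Lemma updE f x w v : upd f x w v = if v == x then w else f v.
Proof. by rewrite ffunE. Qed.

Section AddEdge.
Variables (S : {set T}) (x w : T) (f : {ffun T -> T}).
Hypotheses (xS : x \in S) (fS : f \in forests (S :\ x)).
Hypotheses (xw : r x w) (wx : froot f w != x).

Let fix_upd u : u \notin S -> upd f x w u = u.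
Proof.
move=> uS; rewrite updE; case: eqP => [ux|_]; first by rewrite ux xS in uS.
by case/forestsP: fS => _ -> //; rewrite inE (negbTE uS) andbF.
Qed.

Let root_notin u : froot f u != x -> froot f u \notin S.
Proof.
by move=> ux; case/forestsP: fS => _ _ /(_ u); rewrite !inE ux.
Qed.

Let hit u i : iter i f u = x -> froot f u = x.
Proof.
move=> ui; case/forestsP: fS => _ h _.
by rewrite (@froot_eq _ _ _ i h) ui // !inE eqxx.
Qed.

Let iter_upd u : froot f u != x -> iter #|T| (upd f x w) u = froot f u.
Proof.
move=> ux; have [//|[i _ [_ /hit h]]] : iter #|T| (upd f x w) u = iter #|T| f u \/
   exists2 i, i <= #|T| & iter i (upd f x w) u = x /\ iter i f u = x.
  by apply: iter_agree => z zx; rewrite updE (negbTE zx).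
by rewrite h eqxx in ux.
Qed.

(** The tree of [x] is hung below [w], which lies in another tree: paths that never meet [x] are
    unaffected, and those that do continue from [w]. *)
Lemma froot_upd v :
  froot (upd f x w) v = if froot f v == x then froot f w else froot f v.
Proof.
case: ifPn => [/eqP vx|]; last exact: iter_upd.
have [i hi] : exists i, iter i (upd f x w) v = x.
  have [h|[i _ [h _]]] : iter #|T| (upd f x w) v = iter #|T| f v \/
     exists2 i, i <= #|T| & iter i (upd f x w) v = x /\ iter i f v = x.
    by apply: iter_agree => z zx; rewrite updE (negbTE zx).
  by exists #|T|; rewrite h.
  by exists i.
have e : iter (#|T| + i.+1) (upd f x w) v = froot f w.
  by rewrite iterD iterS hi updE eqxx iter_upd.
by rewrite -e; apply: (froot_eq fix_upd); rewrite e root_notin.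
Qed.

Lemma upd_forest : upd f x w \in forests S.
Proof.
apply/forestsP; split=> [v vS|v|v]; last 2 first.
- exact: fix_upd.
- by rewrite froot_upd; case: ifPn => [_|]; exact: root_notin.
rewrite updE; case: eqP => [->//|/eqP vx].
by case/forestsP: fS => -> //; rewrite !inE vx.
Qed.

End AddEdge.

(** If the old parent of [x] still led to [x] after the cut, [f] would have a cycle through [x],
    whereas its paths leave [S]. *)
Lemma cut_forest S x f : x \in S -> f \in forests S ->
  [/\ upd f x x \in forests (S :\ x), r x (f x) & froot (upd f x x) (f x) != x].
Proof.
move=> xS fS; have /forestsP[h1 h2 h3] := fS.
have agree u n := @iter_agree x (upd f x x) f u n
  (fun z zx => etrans (updE f x x z) (ifN _ _ zx)).
have stay u i n : i <= n -> iter i (upd f x x) u = x -> iter n (upd f x x) u = x.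
  by move=> ni e; rewrite -(subnK ni) iterD e iter_fix // updE eqxx.
split; [|exact: h1|].
  apply/forestsP; split=> [v|v|v].
  - by rewrite !inE updE => /andP[/negbTE-> /h1].
  - rewrite !inE updE; case: eqP => [->//|_] /=; exact: h2.
  - rewrite !inE negb_and negbK; case: (agree v #|T|) => [h|[i iT [h _]]].
      by rewrite /froot h h3 orbT.
    by rewrite /froot (stay _ _ _ iT h) eqxx.
apply/negP => /eqP e.
have [i hi] : exists i, iter i f (f x) = x.
  by case: (agree (f x) #|T|) => [h|[i _ [_ h]]]; [exists #|T|; rewrite -h|exists i].
have cyc n : iter (n * i.+1) f x = x.
  by elim: n => // n IH; rewrite mulSn iterD IH iterSr hi.
have := iter_outside h2 (leq_pmulr #|T| (ltn0Sn i)) (h3 x).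
rewrite cyc => ex; have := h3 x; by rewrite /froot -ex xS.
Qed.

(** A forest of [S] is the same as a forest with the extra root [x] together with an arc from [x]
    into another tree; the inverse map is [f] to [(upd f x x, f x)]. *)
Lemma sum_forests S x (G : {ffun T -> T} -> nat) : x \in S ->
  \sum_(f in forests S) G f =
  \sum_(f in forests (S :\ x)) \sum_(w | r x w && (froot f w != x)) G (upd f x w).
Proof.
move=> xS; rewrite pair_big_dep /=.
rewrite (reindex_onto (fun p : {ffun T -> T} * T => upd p.1 x p.2)
                      (fun f => (upd f x x, f x))) /=; last first.
  by move=> f _; apply/ffunP => v; rewrite !updE; case: eqP => [->|].
apply: eq_bigl => -[f w] /=; apply/andP/andP => [[h /eqP[]]|[h /andP[h1 h2]]].
  rewrite updE eqxx; have [h1 h2 h3] := cut_forest xS h => e _.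
  by move: h1 h2 h3; rewrite e updE eqxx => -> -> ->.
split; first exact: upd_forest.
rewrite xpair_eqE updE !eqxx andbT; apply/eqP/ffunP => v; rewrite !updE.
case: eqP => [->|//]; case/forestsP: h => _ h _.
by rewrite h // !inE eqxx.
Qed.

(** For [y] outside [S], dividing by [#|forests S|] gives the potential of the root [y]: harmonic on
    [S], 1 at [y] and 0 at the other roots. *)
Definition nroot S y v := #|[set f in forests S | froot f v == y]|.

Lemma nrootE S y v : nroot S y v = \sum_(f in forests S) (froot f v == y).
Proof.
rewrite /nroot -sum1_card big_mkcond [RHS]big_mkcond /=.
by apply: eq_bigr => f _; rewrite inE; case: (f \in _); case: eqP.
Qed.

Lemma nroot_self S y : y \notin S -> nroot S y y = #|forests S|.
Proof.
move=> yS; congr #|pred_of_set _|; apply/setP => f; rewrite inE.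
by case: (boolP (f \in _)) => // fS; rewrite (froot_outside fS yS) eqxx.
Qed.

Lemma nroot_outside S y v : v \notin S -> v != y -> nroot S y v = 0.
Proof.
move=> vS vy; rewrite nrootE big1 // => f fS.
by rewrite (froot_outside fS vS) (negbTE vy).
Qed.

Lemma sum_nroot_le S (Y : {set T}) v : \sum_(y in Y) nroot S y v <= #|forests S|.
Proof.
under eq_bigr do rewrite nrootE.
rewrite exchange_big /= -sum1_card; apply: leq_sum => f fS.
have [fY|fY] := boolP (froot f v \in Y).
  rewrite (bigD1 _ fY) /= eqxx big1 // => y /andP[_ yf].
  by rewrite eq_sym (negbTE yf).
by rewrite big1 // => y yY; case: eqP => // e; rewrite e yY in fY.
Qed.

(* Writing a forest as a forest with the additional root [x] plus an edge leaving
   [x], the identity holds for each of the former separately. *)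
Lemma nroot_harmonic S x y : x \in S -> y \notin S ->
  \sum_(z | r x z) nroot S y x = \sum_(z | r x z) nroot S y z.
Proof.
move=> xS yS.
have expand (u : T -> T) : \sum_(z | r x z) nroot S y (u z) =
  \sum_(f in forests (S :\ x)) \sum_(w | r x w && (froot f w != x)) 
    \sum_(z | r x z) (froot (upd f x w) (u z) == y).
  under eq_bigr do rewrite nrootE.
  by rewrite exchange_big /= (sum_forests _ xS).
rewrite (expand (fun=> x)) (expand id); apply: eq_bigr => f fS.
have fx : froot f x = x by rewrite (froot_outside fS) // !inE eqxx.
have split1 (u : T -> T) : \sum_(w | r x w && (froot f w != x)) \sum_(z | r x z)
     (froot (upd f x w) (u z) == y) =
  \sum_(w | r x w && (froot f w != x)) (\sum_(z | r x z && (froot f z == x))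
     (froot (upd f x w) (u z) == y) + \sum_(z | r x z && (froot f z != x))
     (froot (upd f x w) (u z) == y)).
  by apply: eq_bigr => w _; rewrite (bigID (fun z => froot f z == x)).
rewrite (split1 (fun=> x)) (split1 id) !big_split /=; congr addn.
  apply: eq_bigr => w /andP[xw wx]; apply: eq_bigr => z /andP[_ zx].
  by rewrite !(froot_upd xS fS) // fx eqxx zx.
rewrite [RHS]exchange_big /=; apply: eq_bigr => w /andP[xw wx].
apply: eq_bigr => z /andP[xz zx].
by rewrite !(froot_upd xS fS) // fx eqxx (negbTE wx).
Qed.

(** Pair each forest of [S] with an arc from [y] to [w]: either [w] lies in the tree of [y], or
    adding the arc gives a forest of [y |: S]. Thus the ratio of the two forest counts is the flux
    of the potential out of [y]. *)
Lemma forests_addroot S y : y \notin S ->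
  #|forests (y |: S)| + \sum_(w | r y w) nroot S y w = \sum_(w | r y w) #|forests S|.
Proof.
move=> yS; rewrite -sum1_card (@sum_forests _ y) ?setU11 // setU1K //.
under [X in _ + X = _]eq_bigr do rewrite nrootE.
rewrite exchange_big /= -big_split /=.
under [RHS]eq_bigr do rewrite -sum1_card.
rewrite [RHS]exchange_big /=; apply: eq_bigr => f _.
rewrite [RHS](bigID (fun w => froot f w != y)) /=; congr addn.
rewrite -big_mkcondr /=.
by rewrite (eq_bigl (fun i => r y i && ~~ (froot f i != y))) // => w; rewrite negbK.
Qed.

End RootedForests.

(** * A growth inequality for the sizes of level sets *)

Section GrowthSequence.
Local Open Scope ring_scope.
Variables (F : realFieldType) (D c m M : nat) (psi : F) (a b : nat -> nat).
Hypotheses (D0 : (0 < D)%N) (m0 : (0 < m)%N) (psi0 : 0 <= psi).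
Hypothesis grow : forall j,
  (b j)%:R <= D%:R * ((a j.+1)%:R - (a j)%:R) + psi * (j.+1 * j.+2)%:R.
Hypothesis b_gt0 : forall j, (0 < b j)%N.
Hypothesis iso : forall j, (a j ^ 2 <= c * (b j + D * m) ^ 3)%N.
Hypothesis a0_gt0 : (0 < a 0)%N.
Hypothesis aM : forall j, (a j <= M)%N.

Variables g q s : nat.
Hypotheses (g0 : (0 < g)%N) (qE : q = (28 * g * D)%N) (sE : s = (2 * g * D * m)%N).
Hypothesis qg : (q ^ 2 * c <= g ^ 3)%N.

Let gs : (g <= s)%N.
Proof.
by rewrite sE -mulnA mulnAC leq_pmull // !muln_gt0 D0 m0.
Qed.
Let s0 : (0 < s)%N. Proof. exact: leq_trans gs. Qed.

(* If [psi] were smaller, then [a] would grow by at least 1 per step up to time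
   [s ^ 3], and from then on [q * a (s ^ 3 + i) >= (s + i) ^ 3]. *)
Lemma growth_sequence : 1 < 36 * (s ^ 6)%:R * psi.
Proof.
rewrite ltNge; apply/negP => small.
have sR : 1 <= s%:R :> F by rewrite ler1n.
rewrite natrX in small.
have linear j : (j <= s ^ 3)%N -> (j < a j)%N.
  elim: j => // j IH js; apply: leq_ltn_trans (IH (ltnW js)) _.
  rewrite -(ltr_nat F) -subr_gt0 -(@pmulr_rgt0 _ D%:R) ?ltr0n //.
  suff : psi * (j.+1 * j.+2)%:R < 1.
    have := grow j; have : 1 <= (b j)%:R :> F by rewrite ler1n.
    lra.
  have : (j.+1 * j.+2)%:R <= 2 * s%:R ^+ 6 :> F.
    rewrite -natrX -natrM ler_nat (_ : s ^ 6 = s ^ 3 * s ^ 3)%N; last by rewrite -expnD.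
    have : (1 <= s ^ 3)%N by rewrite expn_gt0 s0.
    by move: (s ^ 3)%N js => z; nia.
  have := exprn_ge0 6 (ler0n F s).
  move: (s%:R ^+ 6) small ((j.+1 * j.+2)%:R) => z small y z0 yz.
  apply: (@le_lt_trans _ _ (psi * (2 * z))); first exact: ler_wpM2l.
  by nra.
have cubic i : ((s + i) ^ 3 <= q * a (s ^ 3 + i))%N.
  elim: i => [|i]; first by rewrite !addn0; have := linear _ (leqnn (s ^ 3)%N);
    move: g0; rewrite qE; nia.
  rewrite !addnS; set j := (s ^ 3 + i)%N; set x := (s + i)%N => IH.
  have x_s : (s <= x)%N by rewrite leq_addr.
  (* The isoperimetric bound turns [x ^ 3 <= q * a j] into [x ^ 2 <= g * (b j + D * m)]; by the
     choice of [s] the error [g * D * m] is half of [s <= x ^ 2] and is absorbed. *)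
  have x2 : (x ^ 2 <= 2 * g * b j)%N.
    have : (x ^ 2 <= g * (b j + D * m))%N.
      rewrite -(leq_exp2r _ _ (e := 3)) // -expnM mulnC expnM.
      apply: (leq_trans (n := (q * a j) ^ 2)%N); first by rewrite leq_exp2r.
      rewrite !expnMn (leq_trans (leq_mul (leqnn _) (iso j))) // mulnA.
      exact: leq_mul.
    have x_x2 : (x <= x ^ 2)%N by rewrite -mulnn leq_pmulr // (leq_trans s0).
    have : (s <= x ^ 2)%N := leq_trans x_s x_x2.
    by rewrite sE; move: (x ^ 2)%N => y; lia.
  have jx : (j.+1 * j.+2 <= 9 * s ^ 4 * x ^ 2)%N.
    have -> : (9 * s ^ 4 * x ^ 2 = (3 * s ^ 2 * x) * (3 * s ^ 2 * x))%N by ring.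
    suff h : (j.+2 <= 3 * s ^ 2 * x)%N by apply: leq_mul => //; exact: ltnW.
    have s20 : (0 < s ^ 2)%N by rewrite expn_gt0 s0.
    have -> : j.+2 = (s ^ 2 * s + i + 2)%N by rewrite /j; ring.
    by rewrite /x; move: (s ^ 2)%N s20 => z; nia.
  (* The flux term costs at most half of [b j >= x ^ 2 / (2 * g)], so [q * a] grows by at least
     [7 * x ^ 2], which covers the increment [3 * x ^ 2 + 3 * x + 1] of the cube. *)
  have psix : 4 * g%:R * (psi * (j.+1 * j.+2)%:R) <= x%:R ^+ 2.
    have gs2 : g%:R <= s%:R ^+ 2 :> F.
      by rewrite -natrX ler_nat (leq_trans gs) // -mulnn leq_pmulr.
    apply: (@le_trans _ _ (4 * s%:R ^+ 2 * (psi * (9 * s ^ 4 * x ^ 2)%:R))).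
      apply: ler_pM; [by rewrite mulr_ge0 ?ler0n|by rewrite mulr_ge0 ?ler0n|by rewrite ler_wpM2l|].
      by apply: ler_wpM2l => //; rewrite ler_nat.
    rewrite (natrM _ (9 * s ^ 4)%N) (natrM _ 9%N) !natrX.
    have -> : 4 * s%:R ^+ 2 * (psi * (9 * s%:R ^+ 4 * x%:R ^+ 2)) =
      36 * s%:R ^+ 6 * psi * x%:R ^+ 2 by ring.
    by rewrite ler_piMl // exprn_ge0.
  have inc : x%:R ^+ 2 <= 4 * g%:R * D%:R * ((a j.+1)%:R - (a j)%:R) :> F.
    have h1 : 2 * x%:R ^+ 2 <= 4 * g%:R * (b j)%:R :> F.
      by rewrite -natrX -!natrM ler_nat; move: x2; rewrite -!mulnA; lia.
    have : 4 * g%:R * (b j)%:R <= 4 * g%:R * (D%:R * ((a j.+1)%:R - (a j)%:R)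
        + psi * (j.+1 * j.+2)%:R) :> F.
      by apply: ler_wpM2l (grow j); rewrite mulr_ge0.
    by rewrite mulrDr mulrA; lra.
  have {}inc : 7 * x%:R ^+ 2 <= q%:R * (a j.+1)%:R - q%:R * (a j)%:R :> F.
    by rewrite qE !natrM; move: inc; lra.
  have : (7 * x ^ 2 + q * a j <= q * a j.+1)%N.
    rewrite -(ler_nat F) natrD (natrM _ 7%N) natrX (natrM _ _ (a j)) (natrM _ _ (a j.+1)).
    by move: inc; lra.
  have x1 : (0 < x)%N by exact: leq_trans x_s.
  have -> : (x.+1 ^ 3 = x ^ 3 + 3 * x ^ 2 + 3 * x + 1)%N by ring.
  have : (x <= x ^ 2)%N by rewrite -mulnn leq_pmulr.
  move: IH x1; move: (x ^ 3)%N (x ^ 2)%N (q * a j)%N (q * a j.+1)%N => x3 x2' u v.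
  by clear; lia.
have := cubic (q * M).+1; rewrite leqNgt => /negP; apply.
apply: (@leq_ltn_trans (q * M)%N); first by rewrite leq_mul2l aM orbT.
apply: (@leq_trans (s + (q * M).+1)%N); first by rewrite leq_addl.
by rewrite -{1}(expn1 (s + _)) leq_pexp2l // addn_gt0 s0.
Qed.

End GrowthSequence.

(** * Fluxes and a lower bound on conductances *)

Section Conductance.
Local Open Scope ring_scope.
Variables (F : realFieldType) (T : finType) (r : rel T).
Hypothesis r_sym : symmetric r.
Implicit Types (A S U X Y : {set T}).

Definition out_arcs A := [set p : T * T | [&& r p.1 p.2, p.1 \in A & p.2 \notin A]].

Lemma sum_out_arcs (R : nmodType) A (k : T -> T -> R) :
  \sum_(p in out_arcs A) k p.1 p.2 = \sum_(u in A) \sum_(v | r u v && (v \notin A)) k u v.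
Proof.
rewrite pair_big_dep /=; apply: eq_bigl => -[u v] /=.
by rewrite inE /= andbCA.
Qed.

(** Discrete divergence theorem: by symmetry of [r], the contributions of the arcs inside [A] cancel
    in pairs. *)
Lemma net_flux A (h : T -> F) :
  \sum_(p in out_arcs A) (h p.1 - h p.2) = \sum_(u in A) \sum_(v | r u v) (h u - h v).
Proof.
rewrite (sum_out_arcs A (fun u v => h u - h v)).
under [RHS]eq_bigr => u _ do rewrite (bigID (mem A)) /=.
rewrite big_split /=.
set I := (X in X + _); suff -> : I = 0 by rewrite add0r.
suff : I = - I by lra.
have -> : I = \sum_(u in A) \sum_(v in A) if r u v then h u - h v else 0.
  apply: eq_bigr => u _; rewrite -big_mkcondr.
  by apply: eq_bigl => v; rewrite andbC.
rewrite {1}exchange_big /= -sumrN; apply: eq_bigr => u _.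
rewrite -sumrN; apply: eq_bigr => v _.
by rewrite r_sym; case: (r u v); rewrite ?oppr0 ?opprB.
Qed.

Section Potential.
Variables (D c g : nat) (U X S : {set T}) (y : T).
Hypotheses (D0 : (0 < D)%N) (c0 : (0 < c)%N) (gE : (784 * D ^ 2 * c <= g)%N).
Hypothesis degD : forall v, v \in U -> (#|[set u | r u v]| <= D)%N.
Hypothesis iso : forall A, A \subset U -> A != set0 ->
  (0 < #|out_arcs A|)%N /\ (#|A| ^ 2 <= c * (#|out_arcs A| + D * #|A :&: X|) ^ 3)%N.
Hypotheses (yS : y \notin S) (ySU : y |: S \subset U) (yX : y \in X).

Let tau := #|forests r S|.
Hypothesis tau0 : (0 < tau)%N.
Let h v : F := (nroot r S y v)%:R / tau%:R.
(** By [forests_addroot] this is the flux of the potential [h] out of [y], that is, the conductance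
    between [y] and the other roots. *)
Let phi : F := #|forests r (y |: S)|%:R / tau%:R.

(** The set where [h] exceeds 1/2, stated in integers so as not to mention the field [F]. *)
Definition nroot_half := [set v | (tau < 2 * nroot r S y v)%N].

Let h_half v : (v \in nroot_half) = (1 / 2 < h v).
Proof.
by rewrite inE /h ltr_pdivlMr ?ltr0n // mulrAC ltr_pdivrMr // mul1r mulrC
  -natrM ltr_nat.
Qed.

Let tauR : 0 < tau%:R :> F. Proof. by rewrite ltr0n. Qed.

Let hy : h y = 1.
Proof. by rewrite /h nroot_self // divff // gt_eqF. Qed.

Let h_out v : v \notin y |: S -> h v = 0.
Proof.
by rewrite !inE negb_or => /andP[vy vS]; rewrite /h nroot_outside // mul0r.
Qed.

Let laplacian_h u : u \in y |: S ->
  \sum_(v | r u v) (h u - h v) = if u == y then phi else 0.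
Proof.
rewrite !inE sumrB.
have sumh (k : T -> nat) : \sum_(v | r u v) (k v)%:R / tau%:R =
    (\sum_(v | r u v) k v)%:R / tau%:R :> F.
  by rewrite natr_sum mulr_suml.
rewrite (sumh (fun v => nroot r S y v)) (sumh (fun v => nroot r S y u)).
case: (eqVneq u y) => /= [->|uy] uS; last by rewrite (nroot_harmonic r uS yS) subrr.
rewrite nroot_self // -(forests_addroot r yS) natrD mulrDl.
by rewrite addrK.
Qed.

Let flux A : A \subset y |: S -> y \in A ->
  \sum_(p in out_arcs A) (h p.1 - h p.2) = phi.
Proof.
move=> AS yA; rewrite net_flux (bigD1 _ yA) /= laplacian_h ?setU11 // eqxx.
rewrite big1 ?addr0 // => u /andP[uA uy].
by rewrite laplacian_h ?(negbTE uy) //; exact: (fintype.subsetP AS).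
Qed.

(* The gaps [t j - t j.+1] are of order [j ^ -2], and an arc leaving [A_ j] either
   ends in [A_ j.+1] or uses up at least this gap of the total flux [phi]. *)
Let t j : F := 1 / 2 + 1 / (2 * j.+1%:R).
Let A_ j := [set v | t j <= h v].

Let t_gt j : 1 / 2 < t j.
Proof. by rewrite ltrDl divr_gt0 // mulr_gt0 ?ltr0n. Qed.

Let t_le1 j : t j <= 1.
Proof.
have : (2 * j.+1%:R)^-1 <= 2^-1 :> F.
  by rewrite lef_pV2 ?posrE ?mulr_gt0 ?ltr0n // ler_peMr ?ler0n // ler1n.
by rewrite /t !div1r; move: (2 * _)^-1 => z; lra.
Qed.

Let t_diff j : t j - t j.+1 = (2 * (j.+1 * j.+2)%:R)^-1.
Proof.
rewrite /t natrM -(natr1 j.+1).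
have : j.+1%:R != 0 :> F by rewrite pnatr_eq0.
have : j.+1%:R + 1 != 0 :> F by rewrite natr1 pnatr_eq0.
by move: (j.+1%:R) => x x1 x0; field; rewrite x0 x1.
Qed.

Let A_sub j : A_ j \subset y |: S.
Proof.
apply/fintype.subsetP => v; rewrite inE; apply: contraLR => /h_out->.
by rewrite -ltNge (lt_trans _ (t_gt j)) // divr_gt0 ?ltr0n.
Qed.

Let yA j : y \in A_ j. Proof. by rewrite inE hy. Qed.

Let A_mono j : A_ j \subset A_ j.+1.
Proof.
apply/fintype.subsetP => v; rewrite !inE; apply: le_trans.
by rewrite -subr_ge0 t_diff invr_ge0 mulr_ge0.
Qed.

Let grow j : #|out_arcs (A_ j)|%:R <=
  D%:R * (#|A_ j.+1|%:R - #|A_ j|%:R) + 2 * phi * (j.+1 * j.+2)%:R.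
Proof.
pose E1 := [set p in out_arcs (A_ j) | p.2 \in A_ j.+1].
pose E2 := [set p in out_arcs (A_ j) | p.2 \notin A_ j.+1].
have -> : #|out_arcs (A_ j)|%:R = #|E1|%:R + #|E2|%:R :> F.
  rewrite -natrD -(cardsID [set p | p.2 \in A_ j.+1] (out_arcs (A_ j))).
  by congr (_ + _)%:R; apply: eq_card => p; rewrite !inE andbC.
apply: lerD.
  have -> : #|A_ j.+1|%:R - #|A_ j|%:R = #|A_ j.+1 :\: A_ j|%:R :> F.
    by rewrite cardsDS // natrB // subset_leq_card.
  rewrite -natrM ler_nat mulnC -sum_nat_const.
  rewrite /E1 -sum1_card (partition_big snd (mem (A_ j.+1 :\: A_ j))) /=; last first.
    by move=> p; rewrite !inE => /andP[/and3P[_ _ h1] h2]; rewrite h1 h2.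
  apply: leq_sum => v vA; rewrite sum1dep_card.
  have vU : v \in U.
    apply: (fintype.subsetP ySU); apply: (fintype.subsetP (A_sub j.+1)).
    by move: vA; rewrite !inE => /andP[].
  have inj : injective (fun a : T => (a, v)) by move=> a b [].
  apply: leq_trans (degD vU); rewrite -(card_imset _ inj).
  apply: subset_leq_card; apply/fintype.subsetP => -[a b].
  rewrite !inE /= => /andP[/andP[/and3P[ab _ _] _] /eqP bv].
  by apply/imsetP; exists a; rewrite ?inE -bv // r_sym.
have d0 : 0 < t j - t j.+1 by rewrite t_diff invr_gt0 mulr_gt0.
have : #|E2|%:R * (t j - t j.+1) <= phi.
  rewrite -(flux (A_sub j) (yA j)) mulr_natl -sumr_const.
  rewrite [leRHS](bigID (fun p => p.2 \in A_ j.+1)) /=.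
  rewrite -[leLHS]add0r; apply: lerD.
    apply: sumr_ge0 => p; rewrite !inE -ltNge => /andP[/and3P[_ h1 h2] _].
    by rewrite subr_ge0 (le_trans _ h1) // ltW.
  rewrite [leRHS](eq_bigl (fun p => p \in E2)); last by move=> p; rewrite !inE.
  apply: ler_sum => p; rewrite !inE -!ltNge => /andP[/and3P[_ h1 _] h2].
  by lra.
rewrite t_diff ler_pdivrMr ?mulr_gt0 // => /le_trans; apply.
by rewrite mulrA (mulrC phi).
Qed.

(** The level sets [A_ j] lie in [nroot_half], so they meet [X] in at most [m] vertices;
    [growth_sequence] with [psi = 2 * phi] then bounds [phi] from below, and [72 = 2 * 36]. *)
Lemma forests_addroot_lower :
  (#|forests r S| <= 72 * (2 * g * D) ^ 6 * #|nroot_half :&: X| ^ 6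
                     * #|forests r (y |: S)|)%N.
Proof.
set m := #|_ :&: _|.
have m0 : (0 < m)%N.
  by apply/card_gt0P; exists y; rewrite inE yX h_half hy; lra.
pose q := (28 * g * D)%N; pose s := (2 * g * D * m)%N.
have g0 : (0 < g)%N by apply: leq_trans gE; rewrite !muln_gt0 D0 c0.
(* [784 = 28 ^ 2] matches the factor in [q]; this is the reason for the lower bound imposed on
   [g]. *)
have qg : (q ^ 2 * c <= g ^ 3)%N.
  have -> : (q ^ 2 * c = g ^ 2 * (784 * D ^ 2 * c))%N by rewrite /q; ring.
  by rewrite (expnSr g 2) leq_mul2l gE orbT.
have phi0 : 0 <= 2 * phi by rewrite mulr_ge0 // divr_ge0.
have nz j : A_ j != set0 by apply/set0Pn; exists y.
have AU j : A_ j \subset U by exact: subset_trans (A_sub j) ySU.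
have Am j : (#|A_ j :&: X| <= m)%N.
  apply: subset_leq_card; apply: setSI; apply/fintype.subsetP => v.
  by rewrite h_half inE; exact: lt_le_trans (t_gt j).
have isom j : (#|A_ j| ^ 2 <= c * (#|out_arcs (A_ j)| + D * m) ^ 3)%N.
  apply: leq_trans (iso (AU j) (nz j)).2 _.
  by rewrite leq_mul2l leq_exp2r // leq_add2l leq_mul2l Am !orbT.
have a0 : (0 < #|A_ 0|)%N by rewrite card_gt0.
have := growth_sequence D0 m0 phi0 grow (fun j => (iso (AU j) (nz j)).1)
  isom a0 (fun j => max_card _) g0 (erefl q) (erefl s) qg.
rewrite /phi /s !mulrA ltr_pdivlMr // mul1r -(ler_nat F) => /ltW /le_trans; apply.
rewrite expnMn; move: ((2 * g * D) ^ 6)%N (m ^ 6)%N => k w.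
by rewrite !natrM; lra.
Qed.

End Potential.
End Conductance.

(** * Removing extra roots one at a time *)

Section RemoveRoots.
Local Open Scope nat_scope.

Lemma bin_le_exp2 n k : 'C(n, k) <= 2 ^ n.
Proof.
elim: n k => [|n IH] [|k]; rewrite ?bin0 ?bin0n ?expn_gt0 // binS.
by rewrite expnS mul2n -addnn leq_add.
Qed.

(** The power is at most a falling factorial of [n + k], which is the factorial of [k] times a
    binomial coefficient of at most [2 ^ (n + k)]. *)
Lemma expn_le_fact n k : k <= n -> n ^ k <= k`! * 4 ^ n.
Proof.
move=> kn; apply: (@leq_trans ((n + k) ^_ k)).
  elim: k {kn} => // k IH; rewrite addnS ffactSS expnS leq_mul //.
  by rewrite leqW // leq_addr.
rewrite -bin_ffact mulnC leq_mul2l; apply/orP; right.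
apply: leq_trans (bin_le_exp2 _ _) _.
by rewrite -[4]/(2 ^ 2) -expnM leq_exp2l // mul2n -addnn leq_add2l.
Qed.

Variables (T : finType) (r : rel T) (D c g : nat) (U X : {set T}).
Hypothesis r_sym : symmetric r.
Hypotheses (D0 : 0 < D) (c0 : 0 < c) (gE : 784 * D ^ 2 * c <= g).
Hypothesis degD : forall v, v \in U -> #|[set u | r u v]| <= D.
Hypothesis iso : forall A : {set T}, A \subset U -> A != set0 ->
  0 < #|out_arcs r A| /\ #|A| ^ 2 <= c * (#|out_arcs r A| + D * #|A :&: X|) ^ 3.

Let C1 := 72 * (2 * g * D) ^ 6.

(** The sets [nroot_half r S y] for [y] in [Y] are disjoint, so the one meeting [X] least does so in
    at most [#|X| / #|Y|] vertices; removing that root costs [C1] times the sixth power of this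
    number. *)
Lemma remove_root (Y : {set T}) : Y \subset X :&: U -> Y != set0 ->
  exists2 y, y \in Y & #|Y| ^ 6 * #|forests r (U :\: Y)|
    <= C1 * #|X| ^ 6 * #|forests r (U :\: (Y :\ y))|.
Proof.
rewrite subsetI => /andP[YX YU] /set0Pn[y0 y0Y].
pose S := U :\: Y; pose tau := #|forests r S|.
have [t0|t0] := posnP tau; first by exists y0; rewrite // -/S -/tau t0 muln0.
pose half y := nroot_half r S y :&: X.
case: (@arg_minnP _ y0 (mem Y) (fun y => #|half y|)) => // y yY' ymin.
have {yY'} yY : y \in Y := yY'.
exists y => //; have yS : y \notin S by rewrite inE yY.
have yU : y |: S = U :\: (Y :\ y).
  apply/setP => v; rewrite !inE; case: eqP => //= ->.
  by rewrite (fintype.subsetP YU).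
(* Double counting: [v] lies in at most one half set, since the [nroot r S z v] sum to at most [tau]
   over [z]. *)
have kn : #|Y| * #|half y| <= #|X|.
  apply: (@leq_trans (\sum_(z in Y) #|half z|)).
    by rewrite -sum_nat_const; apply: leq_sum => z zY; exact: ymin.
  have -> : \sum_(z in Y) #|half z| =
      \sum_(v in X) \sum_(z in Y) (tau < 2 * nroot r S z v).
    rewrite exchange_big /=; apply: eq_bigr => z zY.
    rewrite -sum1_card big_mkcond [RHS]big_mkcond /=; apply: eq_bigr => v _.
    by rewrite !inE andbC -/tau; case: (v \in X); case: (tau < _).
  rewrite -sum1_card; apply: leq_sum => v vX.
  have [/existsP[z /andP[zY hz]]|/existsPn none] :=
      boolP [exists z, (z \in Y) && (tau < 2 * nroot r S z v)]; last first.
    by rewrite big1 // => z zY; have := none z; rewrite zY /= => /negbTE->.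
  rewrite (bigD1 _ zY) /= hz big1 // => z' /andP[z'Y z'z].
  apply/eqP; rewrite eqb0 -leqNgt.
  have := sum_nroot_le r S Y v; rewrite (bigD1 _ zY) /= (bigD1 z') ?z'Y //=.
  by move: hz; rewrite -/tau; lia.
have yX : y \in X by exact: (fintype.subsetP YX).
have ySU : y |: S \subset U by rewrite yU subDset subsetUr.
have := forests_addroot_lower rat r_sym D0 c0 gE degD iso yS ySU yX t0.
rewrite -/S -/tau -/(half y) -yU => /(leq_mul (leqnn (#|Y| ^ 6)))/leq_trans; apply.
rewrite mulnA leq_mul2r; apply/orP; right.
by rewrite mulnCA leq_mul2l -expnMn leq_exp2r // kn orbT.
Qed.

(** The factors [(#|X| / j) ^ 6], for [j] from [#|Y|] down to 1, multiply to at most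
    [4 ^ (6 * #|X|)] by [expn_le_fact]. *)
Lemma remove_roots (Y : {set T}) : Y \subset X :&: U ->
  #|forests r (U :\: Y)| <= (C1 * 4 ^ 6) ^ #|X| * #|forests r U|.
Proof.
move=> YXU; have YX : #|Y| <= #|X|.
  by apply: subset_leq_card; apply: subset_trans YXU (subsetIl _ _).
have C1_gt0 : 0 < C1.
  have g0 : 0 < g by apply: leq_trans gE; rewrite !muln_gt0 D0 c0.
  by rewrite muln_gt0 expn_gt0 !muln_gt0 g0 D0.
have step : (#|Y|)`! ^ 6 * #|forests r (U :\: Y)|
    <= C1 ^ #|Y| * (#|X| ^ #|Y|) ^ 6 * #|forests r U|.
  move: {2}#|Y| (erefl #|Y|) YXU => k; elim: k Y {YX} => [|k IH] Y kY YXU.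
    by move: (kY) => /eqP; rewrite cards_eq0 => /eqP->; rewrite cards0 setD0.
  have [|y yY hy] := remove_root YXU; first by rewrite -card_gt0 kY.
  have cY : #|Y :\ y| = k by have := cardsD1 y Y; rewrite yY kY => -[].
  have /IH := cY; rewrite cY (subset_trans (subsetDl _ _) YXU) => /(_ isT) {}IH.
  rewrite kY in hy *; rewrite factS expnMn.
  apply: (@leq_trans (C1 * #|X| ^ 6 * (k`! ^ 6 * #|forests r (U :\: (Y :\ y))|))).
    have := leq_mul hy (leqnn (k`! ^ 6)).
    by move: (k.+1 ^ 6) (k`! ^ 6) (#|X| ^ 6) => *; lia.
  have := leq_mul (leqnn (C1 * #|X| ^ 6)) IH.
  rewrite !expnS [in X in _ -> X]expnMn.
  by move: (C1 ^ k) ((#|X| ^ k) ^ 6) (#|X| ^ 6) => *; lia.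
have f0 : 0 < (#|Y|)`! ^ 6 by rewrite expn_gt0 fact_gt0.
rewrite -(leq_pmul2l f0) (leq_trans step) // mulnA leq_mul2r; apply/orP; right.
apply: (@leq_trans (C1 ^ #|X| * ((#|Y|)`! * 4 ^ #|X|) ^ 6)).
  by rewrite leq_mul ?leq_pexp2l // leq_exp2r // expn_le_fact.
have aux a b x : a ^ x * (b * 4 ^ x) ^ 6 = b ^ 6 * (a * 4 ^ 6) ^ x.
  by rewrite (expnMn b) (expnMn a) -(expnM 4 6) -(expnM 4 x) (mulnC 6) mulnCA.
by rewrite aux.
Qed.

End RemoveRoots.

(** * Restriction and existence of forests *)

Section ForestFacts.
Local Open Scope nat_scope.
Variables (T : finType).
Implicit Types (r : rel T) (A S W K : {set T}) (f : {ffun T -> T}).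

Lemma forest_restrict r r' S S' f f' : f \in forests r S -> S' \subset S ->
  (forall v, v \in S' -> r' v (f v)) -> (forall v, v \in S' -> f' v = f v) ->
  (forall v, v \notin S' -> f' v = v) -> f' \in forests r' S'.
Proof.
move=> /forestsP[_ _ fS] S'S fr' f'f f'id.
apply/forestsP; split=> // [v vS'|v]; first by rewrite f'f // fr'.
apply/negP => vS'; suff same i : i <= #|T| -> iter i f' v = iter i f v.
  have := fS v; rewrite /froot -same // => /negP; apply.
  exact: (fintype.subsetP S'S).
elim: i => // i IH iT; rewrite !iterS -IH ?f'f //; last exact: ltnW.
apply: contraLR vS' => h.
by rewrite /froot (iter_outside f'id (ltnW iT) h).
Qed.

(** Vertices are attached one at a time: some arc leaves the part [W :\: S] not yet covered, and its
    head is outside [W] or already leads to a root outside [W]. *)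
Lemma forests_exist r W :
  (forall A, A \subset W -> A != set0 -> 0 < #|out_arcs r A|) ->
  0 < #|forests r W|.
Proof.
move=> out.
suff H k : forall S f, #|W :\: S| = k -> S \subset W -> f \in forests r S ->
    (forall v, v \in S -> froot f v \notin W) -> 0 < #|forests r W|.
  apply: (H _ set0 [ffun v => v] erefl (sub0set _)) => [|v]; last by rewrite inE.
  by apply/forestsP; split=> v; rewrite ?inE ?ffunE.
elim: k => [|k IH] S f kS SW fS fW.
  move/eqP: kS; rewrite cards_eq0 setD_eq0 => WS.
  have <- : S = W by apply/eqP; rewrite eqEsubset SW.
  by apply/card_gt0P; exists f.
have nz : W :\: S != set0 by rewrite -card_gt0 kS.
have /card_gt0P[[a b]] := out _ (subsetDl _ _) nz.
rewrite !inE /= negb_and negbK => /and3P[rab /andP[aS aW] hb].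
have bW : froot f b \notin W.
  by case: (boolP (b \in S)) hb => [/fW //|bS /= bW]; rewrite (froot_outside fS bS).
have fa : f \in forests r ((a |: S) :\ a) by rewrite setU1K.
have ba : froot f b != a by apply: contraNneq bW => ->.
have up := froot_upd (setU11 a S) fa ba.
apply: (IH (a |: S) (upd f a b)).
- have : #|W :\: S| = (a \in W :\: S) + #|(W :\: S) :\ a| by exact: cardsD1.
  by rewrite kS !inE aS aW setDDl setUC => -[].
- by rewrite subUset sub1set aW.
- exact: upd_forest (setU11 a S) fa rab ba.
move=> v; rewrite up; case: eqP => // va.
rewrite !inE => /orP[/eqP vE|/fW //]; case: va; rewrite vE.
exact: froot_outside fS aS.
Qed.

(** Replacing [e] by [r] loses at most [D] arcs at each vertex of [A :&: X]; this produces the error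
    term in the isoperimetric inequality of each side of a cut. *)
Lemma out_arcs_sub (e r : rel T) W A (X : {set T}) D : A \subset W ->
  (forall v, v \in W -> #|[set u | e v u]| <= D) ->
  (forall u v, u \in A -> e u v -> ~~ r u v -> u \in X) ->
  #|out_arcs e A| <= #|out_arcs r A| + D * #|A :&: X|.
Proof.
move=> AW deg eX.
apply: (@leq_trans (#|out_arcs r A| + #|[set p in out_arcs e A | ~~ r p.1 p.2]|)).
  apply: leq_trans (leq_card_setU _ _).1; apply: subset_leq_card.
  apply/fintype.subsetP => p; rewrite !inE.
  by case/and3P => -> -> ->; rewrite !andbT /= orbN.
rewrite leq_add2l -sum1_card (partition_big fst (mem (A :&: X))) /=; last first.
  by move=> p; rewrite !inE => /andP[/and3P[ep pA _] nr]; rewrite pA (eX _ _ pA ep nr).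
rewrite mulnC -sum_nat_const; apply: leq_sum => u; rewrite inE => /andP[uA _].
rewrite sum1dep_card; have inj : injective (pair u : T -> T * T) by move=> a b [].
apply: leq_trans (deg u (fintype.subsetP AW u uA)); rewrite -(card_imset _ inj).
apply: subset_leq_card; apply/fintype.subsetP => -[a b].
rewrite !inE /= => /andP[/andP[/and3P[ab _ _] _] /eqP <-].
by apply/imsetP; exists b; rewrite ?inE.
Qed.

End ForestFacts.

(** * Cutting a forest along the boundary of a bond *)

Section Cut.
Local Open Scope nat_scope.
Variables (T : finType) (e : rel T) (W : {set T}) (D c g : nat).
Hypotheses (e_sym : symmetric e) (D0 : 0 < D) (c0 : 0 < c) (gE : 784 * D ^ 2 * c <= g).
Hypothesis degW : forall v, v \in W -> #|[set u | e v u]| <= D.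
Hypothesis isoW : forall A : {set T}, A \subset W -> #|A| ^ 2 <= c * #|out_arcs e A| ^ 3.
Implicit Types (K A S X Y : {set T}) (f : {ffun T -> T}).

Let C2 := 72 * (2 * g * D) ^ 6 * 4 ^ 6.

Lemma remove_roots_sub (r : rel T) (U X Y : {set T}) : symmetric r -> subrel r e ->
  U \subset W -> (forall u v, u \in U -> e u v -> ~~ r u v -> u \in X) ->
  (forall A, A \subset U -> A != set0 -> 0 < #|out_arcs r A|) ->
  Y \subset X :&: U ->
  #|forests r (U :\: Y)| <= C2 ^ #|X| * #|forests r U|.
Proof.
move=> r_sym re UW eX out; apply: (remove_roots r_sym D0 c0 gE) => [v vU|A AU A0].
  apply: leq_trans (degW (fintype.subsetP UW v vU)); apply: subset_leq_card.
  by apply/fintype.subsetP => u; rewrite !inE r_sym => /re.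
split; first exact: out.
apply: leq_trans (isoW (subset_trans AU UW)) _.
rewrite leq_mul2l leq_exp2r // (out_arcs_sub (subset_trans AU UW) degW) ?orbT //.
by move=> u v uA; apply: eX; exact: (fintype.subsetP AU).
Qed.

Definition in_rel K : rel T := fun u v => [&& e u v, u \in K & v \in K].
Definition out_rel K : rel T := fun u v => [&& e u v, u \notin K & v \notin K].

Definition inner_boundary K := [set u in K | [exists v, (v \notin K) && e u v]].
Definition outer_boundary K := [set u in W :\: K | [exists v, (v \in K) && e u v]].

(** The third clause says that [K] is connected, the fourth that every vertex of [W :\: K] can be
    joined to the outside of [W] without passing through [K]. *)
Definition bond K := [/\ K != set0, K \subset W,
  forall A, A \subset K -> A != set0 -> A != K ->
    exists2 p, p \in out_arcs e A & p.2 \in K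
  & forall A, A \subset W :\: K -> A != set0 ->
    exists2 p, p \in out_arcs e A & p.2 \notin K].

Lemma inner_boundary_le K : #|inner_boundary K| <= #|out_arcs e K|.
Proof.
apply: (@leq_trans #|[set p.1 | p in out_arcs e K]|); last exact: leq_imset_card.
apply: subset_leq_card; apply/fintype.subsetP => u.
rewrite inE => /andP[uK /existsP[v /andP[vK uv]]].
by apply/imsetP; exists (u, v); rewrite // inE /= uv uK.
Qed.

Lemma outer_boundary_le K : #|outer_boundary K| <= #|out_arcs e K|.
Proof.
apply: (@leq_trans #|[set p.2 | p in out_arcs e K]|); last exact: leq_imset_card.
apply: subset_leq_card; apply/fintype.subsetP => u.
rewrite !inE => /andP[/andP[uK _] /existsP[v /andP[vK uv]]].
by apply/imsetP; exists (v, u); rewrite // inE /= e_sym uv vK.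
Qed.

Section Split.
Variable K : {set T}.
Hypothesis bondK : bond K.
Let n := #|out_arcs e K|.

Definition crossing := [set p : T * T | e p.1 p.2 && ((p.1 \in K) != (p.2 \in K))].

Lemma card_crossing : #|crossing| <= 2 * n.
Proof.
rewrite mul2n -addnn.
have inj : injective (fun p : T * T => (p.2, p.1)) by move=> [a b] [a' b'] [-> ->].
rewrite /n -{2}(card_imset (out_arcs e K) inj).
apply: leq_trans (leq_card_setU _ _).1; apply: subset_leq_card.
apply/fintype.subsetP => -[a b]; rewrite !inE /= => /andP[ab].
case: (boolP (a \in K)); case: (boolP (b \in K)) => //= bK aK _; first by rewrite ab.
by apply/orP; right; apply/imsetP; exists (b, a); rewrite ?inE //= e_sym ab bK.
Qed.

Definition cross_of f := [set p : T * T | (p.2 == f p.1) && ((p.1 \in K) != (p.2 \in K))].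
Definition in_part f : {ffun T -> T} :=
  [ffun v => if (v \in K) && (f v \in K) then f v else v].
Definition out_part f : {ffun T -> T} :=
  [ffun v => if (v \notin K) && (f v \notin K) then f v else v].

Definition starts (E : {set T * T}) := [set p.1 | p in E].

(** Delete the arcs of a forest that cross the boundary and record them as [E]: their tails become
    extra roots, and [E] with the two remaining parts determines the forest. *)
Lemma forests_split : #|forests e W| <= \sum_(E in powerset crossing)
  #|forests (in_rel K) (K :\: starts E)| *
  #|forests (out_rel K) (W :\: K :\: starts E)|.
Proof.
have [_ KW _ _] := bondK.
have start_f f v : (v \in starts (cross_of f)) = ((v \in K) != (f v \in K)).
  apply/imsetP/idP => [[[a b]]|h]; first by rewrite inE /= => /andP[/eqP-> h] ->.
  by exists (v, f v); rewrite ?inE ?eqxx.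
rewrite -sum1_card (partition_big cross_of (mem (powerset crossing))) /=; last first.
  move=> f /forestsP[fe fid _]; rewrite inE; apply/fintype.subsetP => -[a b].
  rewrite !inE /= => /andP[/eqP-> h]; rewrite h andbT fe //.
  by apply: contraLR h => aW; rewrite fid // eqxx.
apply: leq_sum => E _; rewrite sum1dep_card -cardsX.
have inj : {in [set f in forests e W | cross_of f == E] &,
    injective (fun f => (in_part f, out_part f))}.
  move=> f f'; rewrite !inE => /andP[_ /eqP cf] /andP[_ /eqP cf'] [h1 h2].
  apply/ffunP => v; have cc : cross_of f = cross_of f' by rewrite cf cf'.
  have [h|h] := boolP ((v \in K) != (f v \in K)).
    have : (v, f v) \in cross_of f' by rewrite -cc inE /= eqxx.
    by rewrite inE /= => /andP[/eqP].
  have h' : ~~ ((v \in K) != (f' v \in K)) by rewrite -start_f -cc start_f.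
  move: h h' (congr1 (fun k : {ffun T -> T} => k v) h1)
    (congr1 (fun k : {ffun T -> T} => k v) h2); rewrite !ffunE !negbK.
  by do 3!case: (_ \in K).
rewrite -(card_in_imset inj); apply: subset_leq_card.
apply/fintype.subsetP => z /imsetP[f fE ->{z}].
move: fE; rewrite inE => /andP[fW /eqP <-].
have /forestsP[fe _ _] := fW.
rewrite inE /=; apply/andP; split.
- apply: (forest_restrict fW (subset_trans (subsetDl _ _) KW)) => v;
    rewrite !(inE, ffunE) start_f.
  + move=> /andP[]; rewrite negbK => /eqP fv vK.
    by rewrite /in_rel -fv vK fe // (fintype.subsetP KW).
  + by move=> /andP[]; rewrite negbK => /eqP <- ->.
  + by case: (v \in K); case: (f v \in K).
- apply: (forest_restrict fW (subset_trans (subsetDl _ _) (subsetDl _ _))) => v;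
    rewrite !(inE, ffunE) start_f.
  + move=> /and3P[]; rewrite negbK => /eqP fv vK vW.
    by rewrite /out_rel -fv vK fe.
  + by move=> /and3P[]; rewrite negbK => /eqP <- ->.
  + case: (boolP (v \in K)) => //= vK; case: (boolP (f v \in K)) => //= fK.
    rewrite /= => vW; case/forestsP: fW => _ -> //.
Qed.

(** There are at most [4 ^ n] sets [E]. On each side the extra roots are removed at a cost of
    [C2 ^ n], except one in [K], which has no other root; [x] is the boundary vertex for which [K]
    has the most trees so rooted. *)
Lemma forests_cut : exists2 x, x \in inner_boundary K &
  #|forests e W| <= (4 * C2 ^ 2) ^ n *
    (#|forests (in_rel K) (K :\ x)| * #|forests (out_rel K) (W :\: K)|).
Proof.
have [K0 KW bK bC] := bondK.
have C2_gt0 : 0 < C2.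
  have g0 : 0 < g by apply: leq_trans gE; rewrite !muln_gt0 D0 c0.
  by rewrite /C2 !(expn_gt0, muln_gt0) g0 D0.
have C2_le m : m <= n -> C2 ^ m <= C2 ^ n by exact: leq_pexp2l.
have [x0 x0X] : exists x, x \in inner_boundary K.
  have : 0 < n.
    have := isoW KW; rewrite -/n; case: (n) => // /(leq_trans _).
    by move=> /(_ 1); rewrite muln0 expn_gt0 card_gt0 K0 => /(_ isT).
  move=> /card_gt0P[[a b]]; rewrite inE /= => /and3P[ab aK nbK].
  by exists a; rewrite inE aK; apply/existsP; exists b; rewrite nbK.
pose M x := #|forests (in_rel K) (K :\ x)|.
case: (@arg_maxnP _ x0 (mem (inner_boundary K)) M) => // x xX xmax; exists x => //.
rewrite -/(M x); apply: leq_trans forests_split _.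
apply: (@leq_trans (\sum_(E in powerset crossing) C2 ^ n * M x *
    (C2 ^ n * #|forests (out_rel K) (W :\: K)|))); last first.
  rewrite sum_nat_const card_powerset.
  have : 2 ^ #|crossing| <= 4 ^ n by rewrite -[4]/(2 ^ 2) -expnM leq_exp2l // card_crossing.
  move: (C2 ^ 2) (expnMn 4 (C2 ^ 2) n) (expnM C2 2 n) (expnM C2 n 2).
  rewrite (mulnC 2 n) => k -> <- ->.
  rewrite -mulnn; move: (C2 ^ n) (4 ^ n) (2 ^ _) (M x) => u v w m wv.
  apply: leq_trans (leq_mul wv (leqnn _)) _.
  by rewrite eq_leq //; ring.
apply: leq_sum => E; rewrite inE => /fintype.subsetP Ecr; apply: leq_mul.
(* Without a crossing arc starting in [K] there is no forest, as [in_rel K] never leaves [K]. *)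
- have [empty|[a]] := set_0Vmem (K :&: starts E).
    suff -> : forests (in_rel K) (K :\: starts E) = set0 by rewrite cards0.
    rewrite -[K :\: _]setU0 -empty setUC setID.
    apply/setP => f; rewrite [in RHS]inE; apply/negP => /forestsP[fe _ fK].
    have /set0Pn[v vK] := K0.
    suff : forall i, iter i f v \in K by move=> /(_ #|T|); apply/negP; exact: fK.
    by elim=> // i /fe /and3P[].
  (* One root [a] is kept. Every subset of [U] is then proper in [K], so connectedness of [K]
     supplies an arc out of it. *)
  rewrite inE => /andP[aK aE]; pose U := K :\ a; pose Y := (K :&: starts E) :\ a.
  have startX v : v \in K -> v \in starts E -> v \in inner_boundary K.
    move=> vK /imsetP[[b b'] /Ecr]; rewrite !inE /= => /andP[bb' h] vb.
    rewrite vK; apply/existsP; exists b'; rewrite vb bb' andbT.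
    by move: h; rewrite -vb vK; case: (b' \in K).
  have -> : K :\: starts E = U :\: Y.
    apply/setP => v; rewrite !inE; case: (eqVneq v a) => [->|_] /=; first by rewrite aE.
    by case: (v \in K); rewrite ?andbF.
  apply: (@leq_trans (C2 ^ #|inner_boundary K| * M a)); last first.
    apply: leq_mul; first by rewrite C2_le // inner_boundary_le.
    by apply: xmax; exact: (startX a).
  apply: remove_roots_sub => [u v|u v|||A AU A0|].
  + by rewrite /in_rel e_sym [X in _ && X]andbC.
  + by case/and3P.
  + exact: subset_trans (subsetDl _ _) KW.
  + move=> u v; rewrite !inE /in_rel => /andP[_ uK] uv; rewrite uv uK /= => vK.
    by apply/existsP; exists v; rewrite vK.
  + have AK : A \subset K by exact: subset_trans AU (subsetDl _ _).
    have [|p pA pK] := bK A AK A0.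
      by apply: contraTneq AU => ->; apply/subsetPn; exists a; rewrite ?inE ?eqxx.
    apply/card_gt0P; exists p; move: pA; rewrite !inE /in_rel => /and3P[-> pA ->].
    by rewrite pA pK (fintype.subsetP AK).
  + apply/fintype.subsetP => v; rewrite !inE => /and3P[-> vK vE].
    by have := startX v vK vE; rewrite inE vK andbT /= => ->.
- pose Y := (W :\: K) :&: starts E.
  have -> : W :\: K :\: starts E = (W :\: K) :\: Y.
    apply/setP => v; rewrite !inE.
    by case: (v \in K); case: (v \in W); rewrite ?andbF.
  apply: (@leq_trans (C2 ^ #|outer_boundary K| * #|forests (out_rel K) (W :\: K)|)); last first.
    by rewrite leq_mul // C2_le // outer_boundary_le.
  apply: remove_roots_sub => [u v|u v|||A AU A0|].
  + by rewrite /out_rel e_sym [X in _ && X]andbC.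
  + by case/and3P.
  + exact: subsetDl.
  + move=> u v; rewrite !inE /out_rel => /andP[uK uW] uv; rewrite uv uK uW /= negbK => vK.
    by apply/existsP; exists v; rewrite vK.
  + have [p pA pK] := bC A AU A0.
    apply/card_gt0P; exists p; move: pA; rewrite !inE /out_rel => /and3P[-> pA ->].
    have := fintype.subsetP AU _ pA; rewrite pA pK !inE.
    by case/andP => ->.
  + apply/fintype.subsetP => v; rewrite !inE => /andP[/andP[vK ->]].
    move=> /imsetP[[b b'] /Ecr]; rewrite !inE /= => /andP[bb' h] vb.
    rewrite vK !andbT; apply/existsP; exists b'; rewrite vb bb' andbT.
    by move: h; rewrite -vb (negbTE vK); case: (b' \in K).
Qed.

End Split.
End Cut.

(** * Gluing an inner tree to an outer forest *)

Section Gluing.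
Local Open Scope nat_scope.
Variables (T : finType) (e : rel T) (W : {set T}).
Implicit Types (K : {set T}) (f : {ffun T -> T}).

Definition glue K x z f1 f2 : {ffun T -> T} :=
  [ffun v => if v \in K then if v == x then z else f1 v else f2 v].

Section Glue.
Variables (K : {set T}) (x z : T) (f1 f2 : {ffun T -> T}).
Hypotheses (KW : K \subset W) (xK : x \in K) (zK : z \notin K) (xz : e x z).
Hypothesis f1K : f1 \in forests (in_rel e K) (K :\ x).
Hypothesis f2K : f2 \in forests (out_rel e K) (W :\: K).
Let h := glue K x z f1 f2.

Let f1_in v : v \in K -> f1 v \in K.
Proof.
move=> vK; case/forestsP: f1K => fe fid _; case: (eqVneq v x) => [->|vx].
  by rewrite fid // !inE eqxx.
have vKx : v \in K :\ x by rewrite !inE vx.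
by have /and3P[] := fe v vKx.
Qed.

Let f2_out v : v \notin K -> f2 v \notin K.
Proof.
move=> vK; case/forestsP: f2K => fe fid _; case: (boolP (v \in W)) => vW.
  have vWK : v \in W :\: K by rewrite !inE vK.
  by have /and3P[] := fe v vWK.
by rewrite fid // !inE negb_and vW orbT.
Qed.

Let glue_out v i : v \notin K -> iter i h v = iter i f2 v /\ iter i h v \notin K.
Proof.
move=> vK; elim: i => // i [IH1 IH2]; rewrite !iterS /h ffunE -/h (negbTE IH2) IH1.
by split=> //; apply: f2_out; rewrite -IH1.
Qed.

(** Up to its first visit to [x] the path follows [f1], whose only root in [K] is [x]. *)
Lemma glue_hit v : v \in K -> exists2 i, i <= #|K| & iter i h v = x.
Proof.
move=> vK; case/forestsP: f1K => fe fid froot1.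
have hit n : (iter n h v = iter n f1 v /\ iter n f1 v \in K) \/
    exists2 i, i <= n & iter i h v = x.
  elim: n => [|n [[IH1 IH2]|[i ni hi]]]; [by left| |by right; exists i => //; exact: leqW].
  case: (eqVneq (iter n f1 v) x) => [nx|nx]; first by right; exists n; rewrite ?IH1.
  by left; rewrite !iterS IH1 {1}/h ffunE IH2 (negbTE nx) f1_in.
have : iter #|K :\ x| f1 v \notin K :\ x by apply: (iter_exit fid (froot1 v)).
have KxK : #|K :\ x| <= #|K| by exact: subset_leq_card (subsetDl _ _).
case: (hit #|K :\ x|) => [[h1 h2]|[i ni hi] _]; last by exists i => //; exact: leq_trans KxK.
by rewrite !inE h2 andbT negbK => /eqP h3; exists #|K :\ x|; rewrite // h1.
Qed.

Lemma glue_forest : h \in forests e W.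
Proof.
case/forestsP: (f1K) => f1e f1id _; case/forestsP: (f2K) => f2e f2id f2r.
have hid v : v \notin W -> h v = v.
  move=> vW; rewrite ffunE; have vK : v \notin K by apply: contra vW; apply/fintype.subsetP.
  by rewrite (negbTE vK) f2id // !inE (negbTE vW) andbF.
have out v : v \notin K -> iter #|T| h v \notin W.
  move=> vK; have [h1 h2] := glue_out #|T| vK.
  by have := f2r v; rewrite /froot -h1 !inE h2.
apply/forestsP; split=> // [v vW|v].
  rewrite ffunE; case: ifPn => vK; last first.
    have vWK : v \in W :\: K by rewrite !inE vK.
    by have /and3P[] := f2e v vWK.
  case: eqP => [->//|/eqP vx]; have vKx : v \in K :\ x by rewrite !inE vx.
  by have /and3P[] := f1e v vKx.
case: (boolP (v \in K)) => vK; last exact: out.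
have [i _ hi] := glue_hit vK.
suff hT : iter (#|T| + i.+1) h v \notin W by rewrite (froot_eq hid hT).
by rewrite iterD iterS hi /h ffunE xK eqxx; apply: out.
Qed.

(** Paths starting outside [K] follow [f2] and never enter [K], while those starting in [K] pass
    through [x]. *)
Lemma glue_mem v : reflect (exists i, iter i h v = x) (v \in K).
Proof.
apply: (iffP idP) => [/glue_hit[i _ hi]|[i hi]]; first by exists i.
by apply: contraLR xK => vK; rewrite -hi; case: (glue_out i vK).
Qed.

Lemma glue_in_part : f1 = [ffun v => if v \in K :\ x then h v else v].
Proof.
apply/ffunP => v; rewrite !(ffunE, inE); case/forestsP: f1K => _ fid _.
case: (eqVneq v x) => [->|vx] /=; first by rewrite fid // !inE eqxx.
by case: (boolP (v \in K)) => //= vK; rewrite fid // !inE (negbTE vK) andbF.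
Qed.

Lemma glue_out_part : f2 = [ffun v => if v \in W :\: K then h v else v].
Proof.
apply/ffunP => v; rewrite !(ffunE, inE); case/forestsP: f2K => _ fid _.
case: (boolP (v \in K)) => /= vK; first by rewrite fid // !inE vK.
by case: (boolP (v \in W)) => //= vW; rewrite fid // !inE (negbTE vW) andbF.
Qed.

End Glue.

(* A glued forest forgets the cut, but the root [x K] of its inner tree is met
   within [N] steps of the path starting at [o], and [K] is the set of descendants
   of [x K]. *)
Lemma sum_glue (F : {set {set T}}) (o : T) (x z : {set T} -> T) N :
  (forall K, K \in F -> [/\ K \subset W, o \in K & #|K| <= N]) ->
  (forall K, K \in F -> [/\ x K \in K, z K \notin K & e (x K) (z K)]) ->
  \sum_(K in F) #|forests (in_rel e K) (K :\ x K)| * #|forests (out_rel e K) (W :\: K)|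
    <= N.+1 * #|forests e W|.
Proof.
move=> FW Fx.
pose P K := setX (forests (in_rel e K) (K :\ x K)) (forests (out_rel e K) (W :\: K)).
pose Q := [set t : {set T} * ({ffun T -> T} * {ffun T -> T}) | (t.1 \in F) && (t.2 \in P t.1)].
have -> : \sum_(K in F) #|forests (in_rel e K) (K :\ x K)| *
    #|forests (out_rel e K) (W :\: K)| = #|Q|.
  rewrite -sum1_card (eq_bigr (fun K => \sum_(t in P K) 1)); last first.
    by move=> K _; rewrite sum1_card cardsX.
  by rewrite pair_big_dep /=; apply: eq_bigl => t; rewrite [in RHS]inE.
pose H (t : {set T} * ({ffun T -> T} * {ffun T -> T})) :=
  glue t.1 (x t.1) (z t.1) t.2.1 t.2.2.
(* A time at which the path from [o] is at [x K]; by [glue_hit] there is one not exceeding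
   [#|K| <= N]. *)
pose I t := odflt ord0 [pick i : 'I_N.+1 | iter i (H t) o == x t.1].
have QP t : t \in Q -> [/\ t.1 \subset W, x t.1 \in t.1, z t.1 \notin t.1 & e (x t.1) (z t.1)]
    /\ [/\ t.2.1 \in forests (in_rel e t.1) (t.1 :\ x t.1),
        t.2.2 \in forests (out_rel e t.1) (W :\: t.1) & iter (I t) (H t) o = x t.1].
  rewrite inE => /andP[tF]; rewrite inE => /andP[t1 t2].
  have [tW ot tN] := FW _ tF; have [h1 h2 h3] := Fx _ tF; split; split=> //.
  rewrite /I; case: pickP => [i /eqP //|none].
  have [i it hi] : exists2 i, i <= #|t.1| & iter i (H t) o = x t.1.
    by rewrite /H; apply: glue_hit t1 _ ot.
  have iN : i < N.+1 by rewrite ltnS (leq_trans it).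
  by have := none (Ordinal iN); rewrite /= /H hi eqxx.
have mem t v : t \in Q -> reflect (exists i, iter i (H t) v = x t.1) (v \in t.1).
  by move=> /QP[[h1 h2 h3 h4] [h5 h6 _]]; rewrite /H; apply: glue_mem.
(* The time locates [x K] in the glued forest, its descendants give [K], and restricting the forest
   to the two sides recovers both factors. *)
have inj : {in Q &, injective (fun t => (I t, H t))}.
  move=> t t' Qt Qt' [II HH].
  have [_ [t1 t2 tI]] := QP _ Qt; have [_ [t1' t2' tI']] := QP _ Qt'.
  have xx : x t.1 = x t'.1 by rewrite -tI -tI' II HH.
  have KK : t.1 = t'.1.
    by apply/setP => v; apply/(mem t v Qt)/(mem t' v Qt'); rewrite HH xx.
  move: HH KK xx t1 t2 t1' t2'; rewrite /H.
  case: t {tI II Qt} => K [f1 f2]; case: t' {tI' Qt'} => K' [f1' f2'] /=.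
  move=> HH KK _; rewrite -{K'}KK in HH * => t1 t2 t1' t2'.
  have := glue_in_part (z K) f2 t1; rewrite HH -(glue_in_part (z K) f2' t1') => ->.
  by have := glue_out_part (x K) (z K) f1 t2; rewrite HH -(glue_out_part (x K) (z K) f1' t2') => ->.
have -> : N.+1 * #|forests e W| = #|setX [set: 'I_N.+1] (forests e W)|.
  by rewrite cardsX cardsT card_ord.
rewrite -(card_in_imset inj).
apply: subset_leq_card; apply/fintype.subsetP => _ /imsetP[t /QP[[h1 h2 h3 h4] [h5 h6 _]] ->].
by rewrite !inE /=; have := glue_forest h1 h2 h3 h4 h5 h6; rewrite inE.
Qed.

End Gluing.

(** * Exponential bound on the number of bonds in a finite graph *)

Section CountBonds.
Local Open Scope nat_scope.

(** Quantified over all finite graphs, so that [C] depends on [D] and [c] alone. *)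
Definition bond_count_le (D c C : nat) := forall (T : finType) (e : rel T)
    (W : {set T}) (o : T) (n : nat) (F : {set {set T}}),
  symmetric e -> (forall v, v \in W -> #|[set u | e v u]| <= D) ->
  (forall A : {set T}, A \subset W -> #|A| ^ 2 <= c * #|out_arcs e A| ^ 3) ->
  (forall K, K \in F -> [/\ bond e W K, o \in K & #|out_arcs e K| = n]) ->
  #|F| <= C ^ n.

Lemma count_bonds (D c : nat) : 0 < D -> 0 < c -> exists C, bond_count_le D c C.
Proof.
move=> D0 c0; pose g := 784 * D ^ 2 * c.
have := leqnn g; rewrite {1}/g; move: g => g gE.
pose C2 := 72 * (2 * g * D) ^ 6 * 4 ^ 6.
(* The factor [4 * C2 ^ 2] pays for cutting, and [8 * c.+1] absorbs the polynomial number
   [c * n ^ 3 + 1] of positions of the inner root. *)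
exists (4 * C2 ^ 2 * (8 * c.+1)) => T e W o n F e_sym degW isoW FK.
have cut := forests_cut e_sym D0 c0 gE degW isoW; rewrite -/C2 in cut.
pose good K x := (x \in inner_boundary e K) && (#|forests e W| <=
  (4 * C2 ^ 2) ^ n * (#|forests (in_rel e K) (K :\ x)| * #|forests (out_rel e K) (W :\: K)|)).
pose x (K : {set T}) := odflt o [pick y | good K y].
pose z (K : {set T}) := odflt o [pick y | (y \notin K) && e (x K) y].
have xP K : K \in F -> good K (x K).
  move=> /FK[bK _ nK]; rewrite /x; case: pickP => //= none.
  have [y yK hy] := cut K bK; rewrite nK in hy.
  by have := none y; rewrite /good yK hy.
have zP K : K \in F -> [/\ x K \in K, z K \notin K & e (x K) (z K)].
  move=> /xP /andP[]; rewrite inE => /andP[xK /existsP[y hy]] _.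
  by rewrite /z; case: pickP => [y' /= /andP[]|/(_ y)]; rewrite ?hy.
have sizeK K : K \in F -> [/\ K \subset W, o \in K & #|K| <= c * n ^ 3].
  move=> /FK[[_ KW _ _] oK nK]; split=> //; rewrite -nK.
  apply: leq_trans (isoW _ KW); rewrite -mulnn leq_pmulr //.
  by apply/card_gt0P; exists o.
have := sum_glue sizeK zP.
have tau0 : 0 < #|forests e W|.
  apply: forests_exist => A AW; rewrite -card_gt0 => A0.
  have := isoW A AW; rewrite lt0n; case: eqP => // ->.
  by rewrite exp0n // muln0 leqNgt expn_gt0 A0.
have sumF : #|F| * #|forests e W| <= (4 * C2 ^ 2) ^ n *
    \sum_(K in F) #|forests (in_rel e K) (K :\ x K)| * #|forests (out_rel e K) (W :\: K)|.
  rewrite -sum_nat_const big_distrr /=; apply: leq_sum => K /xP /andP[_].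
  by [].
have poly : (c * n ^ 3).+1 <= (8 * c.+1) ^ n.
  case: n {cut good x z xP zP sizeK sumF FK} => [|n]; first by rewrite muln0.
  rewrite expnMn; have : n.+1 ^ 3 <= 8 ^ n.+1.
    by rewrite -[8]/(2 ^ 3) -expnM mulnC expnM leq_exp2r // ltnW // ltn_expl.
  have : c.+1 <= c.+1 ^ n.+1 by rewrite -{1}(expn1 c.+1) leq_pexp2l.
  have : 0 < 8 ^ n.+1 by rewrite expn_gt0.
  by move: (n.+1 ^ 3) (8 ^ n.+1) (c.+1 ^ n.+1) => u v w; nia.
move=> sumN; rewrite -(leq_pmul2r tau0) (leq_trans sumF) // (expnMn (4 * C2 ^ 2)) -mulnA leq_mul2l.
by rewrite (leq_trans sumN) ?orbT // leq_mul2r poly orbT.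
Qed.

End CountBonds.

(** * Transfer to finite subsets of a locally finite graph *)

Section LocallyFinite.
Local Open Scope nat_scope.
Local Open Scope fset_scope.
Variables (V : choiceType) (adj : rel V) (nb : V -> {fset V}).
Hypothesis adj_sym : symmetric adj.
Hypothesis nbE : forall u v, (v \in nb u) = adj u v.
Implicit Types (K A B : {fset V}).

Definition arcs K : seq (V * V) :=
  [seq p <- [seq (u, v) | u <- enum_fset K, v <- enum_fset (nb u)] | p.2 \notin K].

Lemma mem_arcs K p : (p \in arcs K) = [&& p.1 \in K, p.2 \notin K & adj p.1 p.2].
Proof.
rewrite mem_filter andbCA; congr andb; case: p => a b /=.
apply/allpairsPdep/andP => [[u [v [uK vu [-> ->]]]]|[aK ab]].
  by rewrite uK -nbE.
by exists a, b; rewrite nbE.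
Qed.

Lemma arcs_uniq K : uniq (arcs K).
Proof.
apply: filter_uniq; apply: allpairs_uniq_dep => [|u _|[u v] [u' v'] _ _ [-> ->] //];
  exact: fset_uniq.
Qed.

(** The second clause says that [K] is connected, the third that its complement has no finite
    component. *)
Definition fbond K := [/\ K != fset0,
  forall A, A `<=` K -> A != fset0 -> A != K ->
    exists2 p, p \in arcs A & p.2 \in K
  & forall A, [disjoint A & K] -> A != fset0 ->
    exists2 p, p \in arcs A & p.2 \notin K].

Section Restriction.
Variable W : {fset V}.
(** Adding the neighbours of [W] keeps every arc that leaves a subset of [W], so boundaries are not
    changed. *)
Let T0 : {fset V} := W `|` \bigcup_(u <- enum_fset W) nb u.
Let e : rel T0 := fun u v => adj (val u) (val v).
Let lower K : {set T0} := [set v | val v \in K].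
Let raise (A : {set T0}) : {fset V} := [fset val v | v in A].

Let in_T0 u v : u \in W -> adj u v -> v \in T0.
Proof.
move=> uW uv; rewrite inE; apply/orP; right.
by apply/bigfcupP; exists u; rewrite ?nbE ?uW.
Qed.

Let WT0 : W `<=` T0. Proof. exact: fsubsetUl. Qed.

Let mem_raise (A : {set T0}) (v : T0) : (val v \in raise A) = (v \in A).
Proof. by rewrite mem_imfset //=; exact: val_inj. Qed.

Let raiseP (A : {set T0}) u : reflect (exists2 v : T0, v \in A & u = val v) (u \in raise A).
Proof. exact: imfsetP. Qed.

Lemma lowerK K : K `<=` T0 -> raise (lower K) = K.
Proof.
move=> KT; apply/fsetP => u; apply/raiseP/idP => [[v]|uK]; first by rewrite inE => + ->.
by exists [` fsubsetP KT u uK]; rewrite ?inE.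
Qed.

Lemma card_raise (A : {set T0}) : #|` raise A| = #|A|.
Proof. by rewrite card_imfset /=; [rewrite -cardE|exact: val_inj]. Qed.

Lemma raise_eq0 (A : {set T0}) : (raise A == fset0) = (A == set0).
Proof. by rewrite -cardfs_eq0 card_raise cards_eq0. Qed.

Lemma size_arcs_raise (A : {set T0}) : A \subset lower W ->
  size (arcs (raise A)) = #|out_arcs e A|.
Proof.
move=> AW; pose h (p : T0 * T0) := (val p.1, val p.2).
have hinj : injective h by move=> [a b] [a' b'] [/val_inj-> /val_inj->].
rewrite cardE -(size_map h); apply/eqP; rewrite -uniq_size_uniq ?arcs_uniq //.
  by rewrite map_inj_uniq // enum_uniq.
move=> p; rewrite mem_arcs; apply/mapP/and3P => [[[a b]]|[]].
  by rewrite mem_enum inE /= => /and3P[ab aA bA] -> /=; rewrite !mem_raise.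
case: p => a b /= /raiseP[u uA ->] bA uv.
have uW : val u \in W by have := fintype.subsetP AW u uA; rewrite inE.
move: bA; rewrite -[b]/(val [` in_T0 uW uv]) mem_raise => bA.
by exists (u, [` in_T0 uW uv]); rewrite // mem_enum inE /= /e /= uv uA bA.
Qed.

Lemma bond_lower K : K `<=` W -> fbond K -> bond e (lower W) (lower K).
Proof.
move=> KW [K0 inK outK]; have KT : K `<=` T0 by exact: fsubset_trans KW WT0.
have lift (A : {set T0}) p : p \in arcs (raise A) -> A \subset lower W ->
    exists2 q : T0 * T0, q \in out_arcs e A & val q.2 = p.2.
  case: p => a b; rewrite mem_arcs /= => /and3P[/raiseP[u uA ->] bA ub] AW.
  have uW : val u \in W by have := fintype.subsetP AW u uA; rewrite inE.
  exists (u, [` in_T0 uW ub]) => //; rewrite inE /= uA -mem_raise.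
  by rewrite /e /= ub bA.
have KlW : lower K \subset lower W.
  by apply/fintype.subsetP => v; rewrite !inE; exact: (fsubsetP KW).
split=> //.
- by rewrite -raise_eq0 lowerK.
- move=> A AK A0 AnK.
  have [|||p pA pK] := inK (raise A).
  + by rewrite -(lowerK KT); apply/fsubsetP => u /raiseP[v vA ->];
      rewrite mem_raise (fintype.subsetP AK).
  + by rewrite raise_eq0.
  + apply: contraNneq AnK => AK'; apply/eqP/setP => v.
    by rewrite inE -AK' mem_raise.
  + have [q qA qp] := lift A p pA (subset_trans AK KlW).
    by exists q; rewrite // inE qp.
- move=> A AWK A0.
  have [||p pA pK] := outK (raise A).
  + apply/fdisjointP => u /raiseP[v vA ->].
    by have := fintype.subsetP AWK v vA; rewrite !inE => /andP[].
  + by rewrite raise_eq0.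
  + have [q qA qp] := lift A p pA (subset_trans AWK (subsetDl _ _)).
    by exists q; rewrite // inE qp.
Qed.

Lemma count_fbonds_in D c C (s : seq {fset V}) o n :
  bond_count_le D c C ->
  (forall v, #|` nb v| <= D) -> (forall A, #|` A| ^ 2 <= c * size (arcs A) ^ 3) ->
  uniq s -> o \in W ->
  (forall K, K \in s -> [/\ K `<=` W, fbond K, o \in K & size (arcs K) = n]) ->
  size s <= C ^ n.
Proof.
move=> bound deg iso us oW sK.
have sT K : K \in s -> K `<=` T0.
  by move=> /sK[KW _ _ _]; exact: fsubset_trans KW WT0.
have -> : size s = #|[set A in map lower s]|.
  rewrite cardsE -(size_map lower); apply/esym/card_uniqP.
  by rewrite map_inj_in_uniq // => K K' Ks K's /(congr1 raise); rewrite !lowerK ?sT.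
apply: (bound _ e (lower W) [` fsubsetP WT0 o oW]).
- by move=> u v; exact: adj_sym.
- move=> v; rewrite inE => vW; apply: leq_trans (deg (val v)).
  rewrite -card_raise; apply: fsubset_leq_card; apply/fsubsetP => u /raiseP[z].
  by rewrite inE /e -nbE => + ->.
- by move=> A AW; rewrite -card_raise -size_arcs_raise.
move=> K'; rewrite inE => /mapP[K Ks ->{K'}]; have [KW bK oK nK] := sK K Ks.
have KlW : lower K \subset lower W.
  by apply/fintype.subsetP => v; rewrite !inE; exact: (fsubsetP KW).
split; [exact: bond_lower|by rewrite inE|].
by rewrite -size_arcs_raise // lowerK // sT.
Qed.

End Restriction.

Lemma count_fbonds D c : 0 < D -> 0 < c -> exists2 C, 0 < C &
  (forall v, #|` nb v| <= D) -> (forall A, #|` A| ^ 2 <= c * size (arcs A) ^ 3) ->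
  forall (s : seq {fset V}) o n, uniq s ->
  (forall K, K \in s -> [/\ fbond K, o \in K & size (arcs K) = n]) ->
  size s <= C ^ n.
Proof.
move=> D0 c0; have [C bound] := count_bonds D0 c0; exists C.+1 => // deg iso s o n us sK.
apply: (@leq_trans (C ^ n)); last by case: (n) => // m; rewrite leq_exp2r.
pose W := o |` \bigcup_(K <- s) K.
apply: (@count_fbonds_in W D c C s o n) => //; first by rewrite fset1U1.
move=> K Ks; have [h1 h2 h3] := sK K Ks; split=> //.
apply: fsubset_trans (fsubsetUr _ _).
by apply/fsubsetP => u uK; apply/bigfcupP; exists K; rewrite ?Ks.
Qed.

End LocallyFinite.

From mathcomp Require Import all_classical all_reals all_analysis.

(** * Bonds with closed boundary, by minimality *)

Section ClosedBond.
Local Open Scope nat_scope.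
Local Open Scope fset_scope.
Variables (V : choiceType) (adj : rel V) (nb : V -> {fset V}).
Hypothesis adj_sym : symmetric adj.
Hypothesis nbE : forall u v, (v \in nb u) = adj u v.
Hypothesis out : forall A : {fset V}, A != fset0 -> 0 < size (arcs nb A).
Implicit Types (K A B : {fset V}).

Variable closed : rel V.

Let all_closed K := all (fun p => closed p.1 p.2) (arcs nb K).

(** Among the finite sets containing [x] with closed boundary take one with the fewest boundary
    arcs; a failure of either bond condition would give such a set with fewer. *)
Lemma exists_closed_fbond x K0 : x \in K0 -> all_closed K0 ->
  exists K, [/\ fbond nb K, x \in K & all_closed K].
Proof.
move=> xK0 clK0.
have ex : exists n, `[< exists K, [/\ x \in K, all_closed K & size (arcs nb K) = n] >].
  by exists (size (arcs nb K0)); apply/asboolP; exists K0.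
case: (ex_minnP ex) => n /asboolP[K [xK clK sK]] nmin; exists K.
have small B p : x \in B -> {subset arcs nb B <= arcs nb K} ->
    p \in arcs nb K -> p \notin arcs nb B -> False.
  move=> xB sub pK pB.
  have : n <= size (arcs nb B).
    apply: nmin; apply/asboolP; exists B; split=> //.
    by apply/allP => q /sub; exact: (allP clK).
  have := @uniq_leq_size _ (p :: arcs nb B) (arcs nb K); rewrite /= pB arcs_uniq.
  move=> /(_ isT); rewrite sK => h1 h2.
  have : (size (arcs nb B)).+1 <= n.
    by apply: h1 => q; rewrite in_cons => /predU1P[->|/sub].
  by rewrite ltnNge h2.
have nz A : A != fset0 -> exists p, p \in arcs nb A.
  by move=> /out; case: (arcs nb A) => // p l _; exists p; rewrite mem_head.
split=> //; split=> [|A AK A0 AnK|A AK A0]; first by apply/fset0Pn; exists x.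
- apply: contrapT => none.
  have noA p : p \in arcs nb A -> p.2 \notin K.
    by move=> pA; apply/negP => pK; apply: none; exists p.
  have B0 : K `\` A != fset0.
    by rewrite fsetD_eq0; apply: contra AnK => KA; rewrite eqEfsubset AK.
  have noB p : p \in arcs nb (K `\` A) -> p.2 \notin K.
    rewrite (mem_arcs nbE) !in_fsetD => /and3P[/andP[p1A p1K]].
    rewrite negb_and negbK => /orP[p2A|//] p12.
    have : (p.2, p.1) \in arcs nb A by rewrite (mem_arcs nbE) /= p2A p1A adj_sym.
    by move=> /noA /=; rewrite p1K.
  have [p pA] := nz _ A0; have [q qB] := nz _ B0.
  have subA : {subset arcs nb A <= arcs nb K}.
    move=> r rA; have := noA r rA; move: rA; rewrite !(mem_arcs nbE).
    by move=> /and3P[r1 _ ->] ->; rewrite (fsubsetP AK).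
  have subB : {subset arcs nb (K `\` A) <= arcs nb K}.
    move=> r rB; have := noB r rB; move: rB; rewrite !(mem_arcs nbE) in_fsetD.
    by move=> /and3P[/andP[_ ->] _ ->] ->.
  (* If [A] has no arc to the rest of [K], whichever of the two pieces contains [x] has a smaller
     boundary, as the other piece owns a boundary arc of [K]. *)
  have [xA|xA] := boolP (x \in A).
    apply: (small A q) => //; first exact: subB.
    by move: qB; rewrite !(mem_arcs nbE) in_fsetD => /and3P[/andP[/negbTE-> _] _ _].
  apply: (small (K `\` A) p) => //; first by rewrite in_fsetD xA.
    exact: subA.
  by move: pA; rewrite !(mem_arcs nbE) in_fsetD => /and3P[-> _ _].
- apply: contrapT => none.
  have inK p : p \in arcs nb A -> p.2 \in K.
    by move=> pA; apply: contrapT => /negP pK; apply: none; exists p.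
  have [p pA] := nz _ A0; have p2K := inK p pA.
  move: (pA); rewrite (mem_arcs nbE) => /and3P[p1A p2A p12].
  (* If all arcs of [A] end in [K], adding [A] to [K] creates no boundary arc and removes the
     reverses of these. *)
  apply: (small (K `|` A) (p.2, p.1)); first by rewrite in_fsetU xK.
  + move=> r; rewrite !(mem_arcs nbE) !in_fsetU negb_or.
    move=> /and3P[/orP[->|r1A] /andP[r2K r2A] r12]; first by rewrite r2K.
    have /inK : r \in arcs nb A by rewrite (mem_arcs nbE) r1A r2A.
    by rewrite (negbTE r2K).
  + by rewrite (mem_arcs nbE) /= p2K adj_sym p12 (fdisjointP AK).
  + by rewrite (mem_arcs nbE) /= !in_fsetU p1A orbT andbF.
Qed.

End ClosedBond.

Lemma enum_of_bounded (T : eqType) (P : T -> Prop) (M : nat) :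
  (forall s : seq T, uniq s -> (forall x, x \in s -> P x) -> (size s <= M)%N) ->
  exists2 s : seq T, (size s <= M)%N & forall x, x \in s <-> P x.
Proof.
move=> bound.
have ex : exists n, `[< exists s : seq T, [/\ uniq s, forall x, x \in s -> P x & size s = n] >].
  by exists 0%N; apply/asboolP; exists [::].
have le_M n : `[< exists s : seq T, [/\ uniq s, forall x, x \in s -> P x & size s = n] >] ->
    (n <= M)%N.
  by move=> /asboolP[s [us sP <-]]; exact: bound.
case: (ex_maxnP ex le_M) => n /asboolP[s [us sP sn]] nmax.
exists s => [|x]; first exact: bound.
split=> [|Px]; first exact: sP.
apply: contraT => xs; have : (n.+1 <= n)%N; last by rewrite ltnn.
apply: nmax; apply/asboolP; exists (x :: s); split; rewrite /= ?xs ?sn //.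
by move=> y; rewrite in_cons => /predU1P[->//|/sP].
Qed.

(** * Neighbour sets and an isoperimetric inequality in integers *)

Section GraphFacts.
Import Pilot.Defs.
Local Open Scope classical_set_scope.
Local Open Scope ring_scope.
Variables (R : realType) (G : graph).

Lemma adjacent_sym : symmetric (@adjacent G).
Proof. by move=> u v; rewrite /adjacent fsetUC. Qed.

Lemma counting_fset (T : choiceType) (X : {fset T}) :
  counting [set` X] = (#|` X|%fset%:R)%:E :> \bar R.
Proof. by rewrite /counting asboolT ?set_fsetK. Qed.

(** Since [counting] is infinite on infinite sets, a finite supremum makes every neighbourhood
    finite; [D] is the supremum rounded up, plus 1 for positivity. *)
Lemma bounded_degree_nb : bounded_degree R G -> exists D (nb : G -> {fset G}),
  [/\ (0 < D)%N, forall u v, (v \in nb u) = adjacent u v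
    & forall v, (#|` nb v|%fset <= D)%N].
Proof.
rewrite /bounded_degree => bd.
have deg_le (v : G) : (degree R v <= ereal_sup (range (degree R (G := G))))%E.
  by apply: ereal_sup_ubound; exists v.
have fin (v : G) : finite_set [set y | adjacent v y].
  apply: contrapT => nfin; have := le_lt_trans (deg_le v) bd.
  by rewrite /degree /counting asboolF // ltxx.
pose nb (v : G) := fset_set [set y | adjacent v y].
have degE (v : G) : degree R v = (#|` nb v|%fset%:R)%:E.
  by rewrite /degree /counting asboolT.
pose r := fine (ereal_sup (range (degree R (G := G)))).
exists (Num.bound r).+1, nb; split=> // [u v|v].
  rewrite in_fset_set //; apply/idP/idP; rewrite inE //.
have := deg_le v; rewrite degE => dv.
have finM : ereal_sup (range (degree R (G := G))) \is a fin_num.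
  by rewrite fin_numE -ltey bd andbT gt_eqF // (lt_le_trans _ dv) // ltNyr.
rewrite -(fineK finM) lee_fin -/r in dv.
rewrite leqW // -(ler_nat R) (le_trans dv) // ltW // archi_boundP //.
exact: le_trans dv.
Qed.

Variables (nb : G -> {fset G}).
Hypothesis nbE : forall u v, (v \in nb u) = adjacent u v.

Lemma counting_edge_boundary (A : {fset G}) :
  (counting (edge_boundary A) <= ((size (arcs nb A))%:R : R)%:E)%E.
Proof.
pose fs := seq_fset tt [seq [fset p.1; p.2]%fset | p <- arcs nb A].
have -> : edge_boundary A = [set` fs].
  apply/seteqP; split=> [e [Ee [u [v [uA vA eE]]]]|e] /=.
    rewrite seq_fsetE; apply/mapP; exists (u, v); rewrite // (mem_arcs nbE) /= uA vA.
    by rewrite /adjacent -eE; apply/asboolP.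
  rewrite seq_fsetE => /mapP[p]; rewrite (mem_arcs nbE) => /and3P[p1 p2 /asboolP pE] ->.
  by split=> //; exists p.1, p.2.
rewrite counting_fset lee_fin ler_nat size_seq_fset.
by rewrite (leq_trans (size_undup _)) // size_map.
Qed.

(** As [d > 4], the exponent [(d - 1) / d] is at least 2/3; cubing the inequality with exponent 2/3
    leaves integers and the constant [k ^- 3], rounded up. *)
Lemma isoperimetric_nat (d : R) : 4 < d -> isoperimetric G d ->
  exists2 c, (0 < c)%N &
    forall A : {fset G}, (#|` A|%fset ^ 2 <= c * size (arcs nb A) ^ 3)%N.
Proof.
move=> d4 [k k0 iso].
exists (Num.bound (k ^- 3)).+1 => // A.
have [->|A0] := eqVneq A fset0; first by rewrite cardfs0.
set a := #|` A|%fset; set n := size _.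
have a1 : 1 <= a%:R :> R by rewrite ler1n cardfs_gt0.
have := le_trans (iso A A0) (counting_edge_boundary A).
rewrite lee_fin -/a -/n => kn.
have kn' : k * a%:R `^ (2 / 3) <= n%:R.
  apply: le_trans kn; rewrite ler_pM2l // ler_powR //.
  by rewrite ler_pdivlMr ?(lt_trans _ d4) //; lra.
have cube : (a%:R `^ (2 / 3)) ^+ 3 = a%:R ^+ 2 :> R.
  by rewrite -powR_mulrn ?powR_ge0 // -powRrM -powR_mulrn ?ler0n //; congr (_ `^ _); field.
have : k ^+ 3 * a%:R ^+ 2 <= n%:R ^+ 3.
  rewrite -cube -exprMn lerXn2r ?nnegrE ?mulr_ge0 ?powR_ge0 ?ler0n //; exact: ltW.
rewrite mulrC -ler_pdivlMr ?exprn_gt0 // => h.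
rewrite -(ler_nat R) natrM !natrX (le_trans h) // mulrC ler_wpM2r ?exprn_ge0 //.
rewrite -natr1 ler_wpDr // ltW // archi_boundP // invr_ge0 exprn_ge0 //; exact: ltW.
Qed.

End GraphFacts.

(* [bernoulli_product] is an outer measure on arbitrary sets, so no measurability is needed. *)
Section BernoulliOuter.
Local Open Scope classical_set_scope.
Local Open Scope ereal_scope.
Variables (R : realType) (I : choiceType) (p : {i01 R}).
Local Notation mu := (bernoulli_product p : set (config_space I) -> \bar R).

Lemma bernoulli_product_mono A B : A `<=` B -> mu A <= mu B.
Proof. exact: (le_mu_ext (bernoulli_content p)). Qed.

Lemma bernoulli_productU2 A B : mu (A `|` B) <= mu A + mu B.
Proof. exact: (outer_measureU2 ((bernoulli_content p)^*)%mu). Qed.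

Lemma bernoulli_product_sigma_subadditive (B : nat -> set (config_space I)) :
  mu (\bigcup_n B n) <= \sum_(n <oo) mu (B n).
Proof. exact: (mu_ext_sigma_subadditive (measure_ge0 (bernoulli_content p))). Qed.

End BernoulliOuter.

(** * The union bound over closed bonds *)

Section Peierls.
Import Pilot.Defs.
Local Open Scope classical_set_scope.
Local Open Scope ring_scope.
Variables (R : realType) (G : graph) (nb : G -> {fset G}).
Hypothesis nbE : forall u v, (v \in nb u) = adjacent u v.
Implicit Types (K : {fset G}) (w : config_space (edge G)).

Definition boundary_edges K : seq (edge G) :=
  pmap insub [seq [fset p.1; p.2]%fset | p <- arcs nb K].

Let edge_of_arc K p : p \in arcs nb K -> [fset p.1; p.2]%fset \in edges G.
Proof. by rewrite (mem_arcs nbE) => /and3P[_ _ /asboolP h]; rewrite inE. Qed.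

Lemma size_boundary_edges K : size (boundary_edges K) = size (arcs nb K).
Proof.
rewrite /boundary_edges size_pmap_sub -(size_map (fun p => [fset p.1; p.2]%fset)).
apply/eqP; rewrite -all_count; apply/allP => e /mapP[p pK ->].
exact: edge_of_arc pK.
Qed.

(** A boundary edge has exactly one endpoint in [K], so the unordered pair determines the arc. *)
Lemma boundary_edges_uniq K : uniq (boundary_edges K).
Proof.
rewrite pmap_sub_uniq // map_inj_in_uniq ?arcs_uniq // => -[a b] [a' b'].
rewrite !(mem_arcs nbE) /= => /and3P[aK bK _] /and3P[a'K b'K _] e.
have : a \in [fset a'; b']%fset by rewrite -e !inE eqxx.
have : b \in [fset a'; b']%fset by rewrite -e !inE eqxx orbT.
rewrite !inE; case: (eqVneq a b') aK => [->|_ aK]; first by rewrite (negbTE b'K).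
case: (eqVneq b a') bK => [->|_ bK]; first by rewrite a'K.
by rewrite orbF /= => /eqP-> /eqP->.
Qed.

Definition closed_boundary K : set (config_space (edge G)) :=
  [set w : config (edge G) | {in boundary_edges K, w =1 (fun=> false)}].

Lemma closed_boundary_prob (p : {i01 R}) K :
  bernoulli_product p (closed_boundary K) = ((1 - p%:num) ^+ size (arcs nb K))%:E.
Proof.
rewrite (bernoulli_productE p (fun=> false) (boundary_edges_uniq K)).
by rewrite big_const_seq count_predT size_boundary_edges iter_mulr_1.
Qed.

(** The cluster itself has closed boundary, since an open arc would extend a path;
    [exists_closed_fbond] replaces it by a bond. *)
Lemma finite_cluster_closed x w :
  (forall A : {fset G}, A != fset0 -> (0 < size (arcs nb A))%N) ->
  ~ connected_to_infinity x w ->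
  exists K, [/\ fbond nb K, x \in K & closed_boundary K w].
Proof.
move=> out /contrapT fin.
have mem y : y \in fset_set (cluster_of w x) = (y \in cluster_of w x).
  by rewrite in_fset_set.
have [||K [bK xK clK]] := @exists_closed_fbond _ _ _ (@adjacent_sym G) nbE out
    (fun u v => ~~ open_adjacent w u v) x (fset_set (cluster_of w x)).
- by rewrite mem inE; exists [::].
- apply/allP => p; rewrite (mem_arcs nbE) !mem => /and3P[/set_mem[s sp sx] np _].
  apply: contraNN np => op; rewrite inE.
  by exists (rcons s p.2); rewrite ?rcons_path ?sp ?sx ?last_rcons.
exists K; split=> // e; rewrite mem_pmap_sub => /mapP[p pK ep].
have /= := allP clK p pK; rewrite /open_adjacent => /asboolPn ncl.
by apply/negbTE/negP => we; apply: ncl; exists e.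
Qed.

Lemma union_bound (p : {i01 R}) (r : R) (s : seq {fset G}) :
  (forall K, K \in s -> (bernoulli_product p (closed_boundary K) <= r%:E)%E) ->
  (bernoulli_product p [set w | exists2 K, K \in s & closed_boundary K w]
    <= ((size s)%:R * r)%:E)%E.
Proof.
elim: s => [|K s IH] hs.
  rewrite mul0r (_ : [set w | _] = set0) ?measure0 //.
  by apply/seteqP; split=> // w [].
have sub : [set w | exists2 K', K' \in K :: s & closed_boundary K' w] `<=`
    closed_boundary K `|` [set w | exists2 K', K' \in s & closed_boundary K' w].
  move=> w [K']; rewrite in_cons => /predU1P[->|K's] h; first by left.
  by right; exists K'.
apply: le_trans (bernoulli_product_mono _ sub) _; apply: le_trans (bernoulli_productU2 _ _ _) _.
rewrite /= -natr1 mulrDl mul1r (addrC _ r) EFinD; apply: leeD.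
  by apply: hs; rewrite mem_head.
by apply: IH => K' K's; apply: hs; rewrite in_cons K's orbT.
Qed.

(** With closing probability [r = 1 / (4 * C)], a closed bond with [n] boundary edges exists around
    [x] with probability at most [(C * r) ^ n = 4 ^ -n], and the sum over [n >= 1] is at most
    1/2. *)
Lemma peierls (C : nat) (x : G) : (0 < C)%N ->
  (forall A : {fset G}, A != fset0 -> (0 < size (arcs nb A))%N) ->
  (forall (s : seq {fset G}) n, uniq s ->
    (forall K, K \in s -> [/\ fbond nb K, x \in K & size (arcs nb K) = n]) ->
    (size s <= C ^ n)%N) ->
  exists2 p : {i01 R}, p%:num < 1 & (0 < bernoulli_product p (connected_to_infinity x))%E.
Proof.
move=> C0 out bound; pose r : R := (4 * C%:R)^-1.
have CR : 1 <= C%:R :> R by rewrite ler1n.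
have r0 : 0 < r by rewrite invr_gt0; lra.
have r1 : r <= 1 by rewrite invf_le1; lra.
have q0 : 0 <= 1 - r by lra.
have q1 : 1 - r <= 1 by lra.
pose p : {i01 R} := Itv01 q0 q1.
have pE : 1 - p%:num = r by rewrite /=; lra.
exists p; first by move: pE; lra.
(* Boundaries are nonempty by [out], so their sizes start at 1. *)
pose P n K := [/\ fbond nb K, x \in K & size (arcs nb K) = n.+1].
have /choice[s sP] n : exists s : seq {fset G}, (size s <= C ^ n.+1)%N /\
    forall K, K \in s <-> P n K.
  have [s' us' K's] := @enum_of_bounded _ (P n) (C ^ n.+1) (fun s us h => bound s _ us h).
  by exists s'.
pose B n := [set w | exists2 K, K \in s n & closed_boundary K w].
have cover : setT `<=` connected_to_infinity x `|` \bigcup_n B n.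
  move=> w _; have [inf|ninf] := pselect (connected_to_infinity x w); first by left.
  right; have [K [bK xK cK]] := finite_cluster_closed out ninf.
  have K0 : (0 < size (arcs nb K))%N by apply: out; apply/fset0Pn; exists x.
  exists (size (arcs nb K)).-1 => //; exists K => //.
  by apply/(sP _).2; split; rewrite // prednK.
(* The bound is weakened to the form [eps / 2 ^ n.+1] that [epsilon_trick0] sums to [eps], here
   1/2. *)
have Bn n : (bernoulli_product p (B n) <= (2^-1 / (2 ^ n.+1)%:R)%:E)%E.
  apply: (@le_trans _ _ ((size (s n))%:R * r ^+ n.+1)%:E).
    apply: union_bound => K /(sP n).2 [_ _ nK].
    by rewrite closed_boundary_prob nK pE.
  rewrite lee_fin; apply: (@le_trans _ _ (C%:R ^+ n.+1 * r ^+ n.+1)).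
    by rewrite ler_wpM2r ?exprn_ge0 ?(ltW r0) // -natrX ler_nat (sP n).1.
  have Cr : C%:R * r = 2^-1 * 2^-1.
    by rewrite /r invfM mulrCA divff ?mulr1 -?invfM; [congr (_^-1); lra|rewrite gt_eqF; lra].
  rewrite -exprMn Cr exprMn natrX -exprVn ler_wpM2r ?exprn_ge0 ?invr_ge0 //.
  rewrite exprS ler_piMr ?invr_ge0 // exprn_ile1 ?invr_ge0 //.
  by rewrite invf_le1; lra.
have tail : (bernoulli_product p (\bigcup_n B n) <= (2^-1 : R)%:E)%E.
  apply: le_trans (bernoulli_product_sigma_subadditive _ _) _.
  apply: le_trans (epsilon_trick0 xpredT _); last by rewrite invr_ge0.
  by apply: lee_nneseries => n _ //; exact: Bn.
have total : (1 <= bernoulli_product p (connected_to_infinity x) + (2^-1 : R)%:E)%E.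
  rewrite -(@bernoulli_productT R (edge G) p); apply: le_trans (bernoulli_product_mono _ cover) _.
  by apply: le_trans (bernoulli_productU2 _ _ _) _; exact: leeD.
rewrite ltNge; apply/negP => le0.
have : (1 <= (2^-1 : R)%:E)%E.
  by apply: le_trans total _; rewrite -[leRHS]add0e leeD2r.
by rewrite lee_fin leNgt invf_lt1 //; lra.
Qed.

End Peierls.

(** * From percolation at some [p < 1] to the critical parameter *)

Local Open Scope ring_scope.

Theorem theorem1p2 (R : realType) (G : graph) (x : G) :
  connected_graph G -> bounded_degree R G ->
  (4%:E < isoperimetric_dim R G)%E -> critical_parameter R G x < 1.
Proof.
move=> _ /bounded_degree_nb[D [nb [D0 nbE deg]]] /ereal_sup_gt[_ [d iso <-]].
rewrite lte_fin => d4; have [c c0 isoc] := isoperimetric_nat nbE d4 iso.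
have [C C0 bound] := count_fbonds (@adjacent_sym G) nbE D0 c0.
have out (A : {fset G}) : A != fset0%fset -> (0 < size (arcs nb A))%N.
  rewrite -cardfs_gt0 => A0; have := isoc A; rewrite lt0n; case: eqP => // ->.
  by rewrite exp0n // muln0 leqNgt expn_gt0 A0.
have [|p p1 pinf] := @peierls R G nb nbE C x C0 out.
  by move=> s n; exact: bound.
(* The set of parameters is bounded below by 0, so its infimum is at most its member [p]. *)
apply: le_lt_trans p1; apply: ge_inf; last by exists p.
by exists 0 => _ [q _ <-].
Qed.
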